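(* If $\mu=-k$ and $k=2,3,\ldots$, then the polynomials in $\mathcal{U}_n^d(W_{-k})$ satisfy the equation $L_\mu P=\lambda_n^{(\mu)}P$ with $\mu=-k$; that is, $$L_{-k}P=\lambda_n^{(-k)}P\qquad\text{for } P\in\mathcal{U}_n^d(W_{-k}),\qquad \lambda_n^{(-k)}=-n(n-2k+d).$$ Furthermore, $$\dim \mathcal{U}_n^d(W_{-k})=\dim\mathcal{P}_n^d,\qquad \text{if } n-2k-1+\frac d2\neq 0 .$$ In particular, the operator $L_{-k}$ has a complete polynomial basis of eigenfunctions if the dimension $d$ is odd.
   Context: For $\mu\in\mathbb{R}$ define $$L_\mu=\Delta-\langle x,\nabla\rangle^2-(2\mu+d)\langle x,\nabla\rangle,$$ where $\Delta$ is the Laplacian on $\mathbb{R}^d$, $\langle x,\nabla\rangle=\sum_{i=1}^d x_i\frac{\partial}{\partial x_i}$, and $\langle x,\nabla\rangle^2$ is this operator applied twice. Put $\lambda_n^{(\mu)}=-n(n+2\mu+d)$. Polynomials are in $d$ variables. $\mathcal{P}_n^d$ is the space of homogeneous polynomials of degree $n$, with $\dim\mathcal{P}_n^d=\binom{n+d-1}{d-1}$. $\mathcal{H}_n^d$ is the space of homogeneous harmonic polynomials of degree $n$ (those with $\Delta Y=0$). For $\mu>-1$, $\mathcal{V}_n^d(W_\mu)$ is the space of orthogonal polynomials of degree $n$ with respect to the weight $W_\mu(x)=(1-\|x\|^2)^\mu$ on the unit ball $B^d=\{x\in\mathbb{R}^d:\|x\|\le1\}$, i.e. polynomials of degree $n$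 that are orthogonal, with respect to integration against $W_\mu$ over $B^d$, to all polynomials of lower degree. For $n<0$, $\mathcal{H}_n^d$ and $\mathcal{V}_n^d(W_\mu)$ are defined to be empty. For a function $g$ and a space $V$, $gV=\{gp:p\in V\}$. For $k=2,3,\ldots$ define $$\mathcal{U}_n^d(W_{-k})=\mathcal{H}_n^d\cup\left(\bigcup_{j=1}^{k-1}\left[\sum_{\nu=0}^{j}a_{j,\nu}^n(1-\|x\|^2)^\nu\right]\mathcal{H}_{n-2j}^d\right)\cup(1-\|x\|^2)^k\,\mathcal{V}_{n-2k}^d(W_k),$$ where, for $1\le j\le k-1$, $$a_{j,\nu}^n=\frac{(-1)^{j-\nu}\,j!\,(-k+1)_j\,(n-j-k+\frac d2)_\nu}{\nu!\,(j-\nu)!\,(-k+1)_\nu\,(n-j-k+\frac d2)_j},\qquad 0\le\nu\le j,$$ with $(a)_m=a(a+1)\cdots(a+m-1)$ the shifted factorial ($(a)_0=1$). In particular $a_{j,j}^n=1$. The coefficients $a_{j,\nu}^n$ are well defined if $n-j-k+\nu+\frac d2$ is not zero. The dimension of $\mathcal{U}_n^d(W_{-k})$ means the dimension of its linear span. That $L_{-k}$ has a complete polynomial basis of eigenfunctions means that its polynomial eigenfunctions contain a basis for the space of all polynomials in $d$ variables.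
   Formalization: The dimension equality also assumes that the coefficients a_{j,ν}^n occurring in U_n^d(W_{-k}) are well defined (n-j-k+ν+d/2 ≠ 0 for 0≤ν<j≤k-1, 2j≤n); the printed condition does not ensure this, e.g. d=k=n=2. *)

(* Defs.v *)
From HB Require Import structures.
From mathcomp.multinomials Require Import mpoly.
From mathcomp Require Import all_boot all_order all_algebra.
From mathcomp Require Import all_classical all_reals all_analysis.

Set Implicit Arguments.
Unset Strict Implicit.
Unset Printing Implicit Defensive.

Import Order.TTheory GRing.Theory Num.Theory.
Import numFieldNormedType.Exports.

Local Open Scope classical_set_scope.
Local Open Scope ring_scope.

Section LinearAlgebra.
Context (K : fieldType) (V : lmodType K).

Definition linspan (A : set V) : set V :=
  [set v | exists (s : seq V) (c : V -> K),
     (forall u, u \in s -> A u) /\ v = \sum_(u <- s) c u *: u].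

Definition linfree (A : set V) : Prop :=
  forall (s : seq V) (c : V -> K), uniq s -> (forall u, u \in s -> A u) ->
    \sum_(u <- s) c u *: u = 0 -> forall u, u \in s -> c u = 0.

Definition is_basis (B S : set V) : Prop := linfree B /\ linspan B = S.

Definition has_dim (S : set V) (N : nat) : Prop :=
  exists b : N.-tuple V, uniq b /\ is_basis [set` b] S.

End LinearAlgebra.

Section LebesgueTuple.
Context (R : realType).

Definition cons_tuple n (x : measurableTypeR R * n.-tuple (measurableTypeR R)) :
  n.+1.-tuple (measurableTypeR R) := [tuple of x.1 :: x.2].

Lemma measurable_cons_tuple n : measurable_fun [set: _] (@cons_tuple n).
Proof. exact: measurable_cons measurable_fst measurable_snd. Qed.

HB.instance Definition _ n := isMeasurableFun.Build _ _ _ _ (@cons_tuple n)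
  (@measurable_cons_tuple n).

Lemma cons_tupleK n (t : n.+1.-tuple (measurableTypeR R)) :
  cons_tuple (thead t, [tuple of behead t]) = t.
Proof. by rewrite [RHS]tuple_eta; apply: val_inj. Qed.

Lemma cons_tuple_inj n : injective (@cons_tuple n).
Proof. by move=> [x s] [y t] /(congr1 val)[-> /val_inj ->]. Qed.

Section Step.
Context n (m : {sigma_finite_measure set (n.-tuple (measurableTypeR R)) -> \bar R}).

Definition lebesgue_cons : set (n.+1.-tuple (measurableTypeR R)) -> \bar R :=
  pushforward (@lebesgue_measure R \x m)%E (@cons_tuple n).

Let mpre A : measurable A -> measurable (@cons_tuple n @^-1` A).
Proof. by rewrite -[X in _ -> measurable X]setTI; exact: measurable_cons_tuple. Qed.

Let lebesgue_cons0 : lebesgue_cons set0 = 0.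
Proof. by rewrite /lebesgue_cons /pushforward preimage_set0 measure0. Qed.

Let lebesgue_cons_ge0 A : (0 <= lebesgue_cons A)%E.
Proof. exact: measure_ge0. Qed.

Let lebesgue_cons_sigma_additive : semi_sigma_additive lebesgue_cons.
Proof.
move=> F mF tF mUF; rewrite /lebesgue_cons /pushforward preimage_bigcup.
apply: measure_semi_sigma_additive.
- by move=> i; exact: mpre.
- apply/trivIsetP => /= i j _ _ ij; rewrite -preimage_setI.
  by move/trivIsetP : tF => /(_ _ _ _ _ ij) ->//; rewrite preimage_set0.
- by rewrite -preimage_bigcup; exact: mpre.
Qed.

HB.instance Definition _ := isMeasure.Build _ _ _ lebesgue_cons
  lebesgue_cons0 lebesgue_cons_ge0 lebesgue_cons_sigma_additive.

Lemma measurable_cons_image (A : set (measurableTypeR R * n.-tuple (measurableTypeR R))) :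
  measurable A -> measurable (@cons_tuple n @` A).
Proof.
move=> mA.
have -> : @cons_tuple n @` A =
    (fun t => (thead t, [tuple of behead t])) @^-1` A.
  apply/seteqP; split => [_ [[x t] Axt <-]|t At] /=.
    by rewrite /cons_tuple/= theadE (_ : [tuple of _] = t)//; exact: val_inj.
  by exists (thead t, [tuple of behead t]) => //; rewrite cons_tupleK.
rewrite -[X in measurable X]setTI.
by apply: (measurable_fun_pair (measurable_tnth ord0) (@measurable_behead _ _ n)).
Qed.

Lemma lebesgue_cons_sigma_finite : sigma_finite setT lebesgue_cons.
Proof.
have /sigma_finiteP[F [TF ndF Foo]] := sigma_finiteT (@lebesgue_measure R).
have /sigma_finiteP[G [TG ndG Goo]] := sigma_finiteT m.
exists (fun i => @cons_tuple n @` (F i `*` G i)).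
  rewrite -image_bigcup; apply/seteqP; split => // t _.
  exists (thead t, [tuple of behead t]); last by rewrite cons_tupleK.
  have [i _ Fi] : (\bigcup_i F i) (thead t) by rewrite -TF.
  have [j _ Gj] : (\bigcup_i G i) [tuple of behead t] by rewrite -TG.
  exists (maxn i j) => //; split => /=.
    by apply: (subsetPset _ _ (ndF _ _ (leq_maxl i j))); exact: Fi.
  by apply: (subsetPset _ _ (ndG _ _ (leq_maxr i j))); exact: Gj.
move=> i; have [mF Fi] := Foo i; have [mG Gi] := Goo i.
split; first by apply: measurable_cons_image; exact: measurableX.
rewrite /lebesgue_cons /pushforward [X in product_measure1 _ _ X](_ : _ = F i `*` G i).
  by rewrite product_measure1E// lte_mul_pinfty// ge0_fin_numE.
by apply/seteqP; split => [x [y Fy /cons_tuple_inj <-//]|x Fx]; exists x.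
Qed.

HB.instance Definition _ := Measure_isSigmaFinite.Build _ _ _ lebesgue_cons
  lebesgue_cons_sigma_finite.

End Step.

(* n-dimensional Lebesgue measure on R^n, as the iterated product measure;
   see [lebesgue_tuple_box] for its value on boxes. *)
Fixpoint lebesgue_tuple (n : nat) :
    {sigma_finite_measure set (n.-tuple (measurableTypeR R)) -> \bar R} :=
  match n with
  | 0 => \d_ ([tuple] : 0.-tuple (measurableTypeR R))
  | n'.+1 => lebesgue_cons (lebesgue_tuple n')
  end.

Lemma lebesgue_tuple_box n (A : 'I_n -> set (measurableTypeR R)) :
  (forall i, measurable (A i)) ->
  lebesgue_tuple n [set t | forall i, A i (tnth t i)] =
  (\prod_(i < n) @lebesgue_measure R (A i))%E.
Proof.
elim: n A => [|n IHn] A mA.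
  by rewrite big_ord0 /= diracE mem_set// => -[].
rewrite big_ord_recl -IHn//= /lebesgue_cons /pushforward.
rewrite -product_measure1E//; last first.
  rewrite (_ : [set t | _] = \bigcap_(i in [set: 'I_n])
      ((fun t : n.-tuple (measurableTypeR R) => tnth t i) @^-1` A (lift ord0 i))).
    apply: fin_bigcap_measurable => // i _.
    by rewrite -[X in measurable X]setTI; exact: measurable_tnth.
  by apply/seteqP; split => [t At i _|t At i]; [exact: At|exact: (At i I)].
congr (product_measure1 _ _ _); apply/seteqP; split => -[x t] /=.
  move=> At; split; first exact: (At ord0).
  by move=> i; have := At (lift ord0 i); rewrite tnthS.
by move=> [Ax At] i; case: (unliftP ord0 i) => [j|] ->; [rewrite tnthS|].
Qed.

End LebesgueTuple.

Section Ball.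
Context (R : realType) (d : nat).

Local Notation polyd := {mpoly R[d]}.

Definition laplacian (p : polyd) : polyd :=
  \sum_(i < d) (p^`M(i))^`M(i).

Definition euler (p : polyd) : polyd := \sum_(i < d) 'X_i * p^`M(i).

Definition Lop (mu : R) (p : polyd) : polyd :=
  laplacian p - euler (euler p) - (2 * mu + d%:R) *: euler p.

Definition lambda (mu : R) (n : nat) : R :=
  - (n%:R * (n%:R + 2 * mu + d%:R)).

Definition homog_space (n : nat) : set polyd :=
  [set p | p \is n.-homog].

Definition harmonic_space (n : int) : set polyd :=
  if n is Posz m then [set Y | homog_space m Y /\ laplacian Y = 0] else set0.

Definition oneBnormsq : polyd := 1 - \sum_(i < d) 'X_i ^+ 2.

Local Notation point := (d.-tuple (measurableTypeR R)).

Definition normsq (x : point) : R := \sum_(i < d) (tnth x i : R) ^+ 2.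

Definition unit_ball : set point := [set x | normsq x <= 1].

Definition weight (mu : R) (x : point) : R := (1 - normsq x) `^ mu.

Definition ball_inner (mu : R) (p q : polyd) : \bar R :=
  \int[lebesgue_tuple R d]_(x in unit_ball)
    (p.@[tnth x] * q.@[tnth x] * weight mu x)%:E.

(* msize p is 1 + deg p, so these are the polynomials of degree <= m orthogonal
   to all polynomials of degree < m; for mu > -1, the only one of degree < m is 0. *)
Definition orth_space (mu : R) (n : int) : set polyd :=
  if n is Posz m then
    [set p | (msize p <= m.+1)%N /\
       forall q : polyd, (msize q <= m)%N -> ball_inner mu p q = 0%E]
  else set0.

Definition poch (a : R) (m : nat) : R := \prod_(i < m) (a + i%:R).

Definition coefa (k n j nu : nat) : R :=
  ((-1) ^+ (j - nu) * j`!%:R * poch (- k%:R + 1) j *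
     poch (n%:R - j%:R - k%:R + d%:R / 2) nu) /
  (nu`!%:R * (j - nu)`!%:R * poch (- k%:R + 1) nu *
     poch (n%:R - j%:R - k%:R + d%:R / 2) j).

(* No denominator of a coefficient occurring in [Uset k n] vanishes; a j with
   n < 2j does not occur because the space of index n - 2j is empty. *)
Definition coefa_well_defined (k n : nat) : Prop :=
  forall j nu : nat, (1 <= j <= k - 1)%N -> (2 * j <= n)%N -> (nu < j)%N ->
    n%:R - j%:R - k%:R + nu%:R + d%:R / 2 != 0 :> R.

Definition Uset (k n : nat) : set polyd :=
  harmonic_space n%:Z
  `|` \bigcup_(j in [set j : nat | (1 <= j <= k - 1)%N])
        [set (\sum_(nu < j.+1) coefa k n j nu *: oneBnormsq ^+ nu) * Y
           | Y in harmonic_space (n%:Z - (2 * j)%:Z)]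
  `|` [set oneBnormsq ^+ k * Q | Q in orth_space k%:R (n%:Z - (2 * k)%:Z)].

Definition polynomial_eigenfunction (T : polyd -> polyd) (p : polyd) : Prop :=
  p != 0 /\ exists c : R, T p = c *: p.

Definition complete_polynomial_eigenbasis (T : polyd -> polyd) : Prop :=
  exists B : set polyd,
    B `<=` polynomial_eigenfunction T /\ is_basis B [set: polyd].

End Ball.

(* Main.v *)
From HB Require Import structures.
Require Import Defs.
From mathcomp.multinomials Require Import mpoly.
From mathcomp Require Import all_boot all_order all_algebra.
From mathcomp Require Import all_classical all_reals all_analysis.
From mathcomp Require Import measurable_realfun.
From mathcomp Require Import zify ring lra.

Set Implicit Arguments.
Unset Strict Implicit.
Unset Printing Implicit Defensive.

Import Order.TTheory GRing.Theory Num.Theory.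
Import numFieldNormedType.Exports.

Local Open Scope classical_set_scope.
Local Open Scope ring_scope.

(** Let u = 1 - |x|^2 and let E be the Euler operator. The members of the three
    components are products of a polynomial in u with a polynomial p, and all
    eigenvalue equations come from one identity, [Lop_uM]:
      L_mu (u^v p) = u^v (L_mu p - 4 v E p - (4 v^2 + 2 v (2 mu + d)) p)
                     + 4 v (v + mu) u^(v-1) p.
    If p is harmonic and homogeneous, this says that L_mu maps u^v p to a
    combination of u^v p and u^(v-1) p, and the coefficients of the second
    component solve the two-term recursion for an eigenvector ([coefa_rec]). If
    v = k and mu = -k, the last term disappears and L_(-k) (u^k p) is
    u^k (L_k p) up to a multiple of u^k p. So the third component reduces to
    the classical fact that the orthogonal polynomials for the weight u^k are
    eigenfunctions of L_k ([orth_space_eigen]). This holds because L_k does not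
    raise degrees, acts by a scalar modulo lower degree, and is symmetric for
    the inner product of the weight. The symmetry is Green's formula for the
    divergence form of L_k; the boundary term is absent because the flux
    contains a factor u. What is needed of integration in d variables is thus
    that a partial derivative of h u integrates to 0 over the ball
    ([ball_integral_mderiv_vanishing]), which follows from Fubini's theorem by
    induction on d, and that the inner product is positive definite ([ip_eq0]).

    For the dimension, consider the map that sends a polynomial of degree at
    most n to its homogeneous part of degree n. Put rho = u - 1 = -|x|^2. When
    the coefficients are well defined, the j-th factor of the second component
    is u^j plus lower powers of u, so the image of a sum of members of the
    family is the sum of rho^j Y_j for j < k plus rho^k times the leading part
    of an orthogonal polynomial Q. Orthogonal projection shows that any
    homogeneous polynomial is the leading part of exactly one Q, and the
    Fischer decomposition, that every homogeneous polynomial is uniquely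
    Y + rho r with Y harmonic; here it comes from the bijectivity of
    r |-> laplacian (rho r), proved by induction on the degree. Iterating,
    the map is a bijection from the span of the family to the homogeneous
    polynomials of degree n ([Uset_lead], [Uset_msize_eq0]).

    Pulling back monomials gives, for each exponent m, an eigenfunction with
    leading part x^m. Those with |m| = n form a basis of the span for n, and if
    the coefficients are well defined for every n, which is automatic for odd d,
    all of them together form a basis of the space of polynomials. *)

(** * Integrable functions on balls *)

Section TameFunctions.
Context (R : realType).
Local Notation point n := (n.-tuple (measurableTypeR R)).

(** Balls of every squared radius, because fixing one coordinate of a point of
    the unit ball leaves a ball of smaller radius in one dimension less. *)
Definition rball n (c : R) : set (point n) := [set t | normsq t <= c].

(** A sufficient condition for integrability on every ball that, unlike
    integrability, is stable under products. *)
Definition tame n (f : point n -> R) : Prop :=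
  measurable_fun [set: point n] f /\
  forall c, exists M, forall t, rball c t -> `|f t| <= M.

Lemma tame_cst n (a : R) : tame (fun _ : point n => a).
Proof. by split; [exact: measurable_cst|move=> c; exists `|a|]. Qed.

Lemma tameD n (f g : point n -> R) :
  tame f -> tame g -> tame (fun t => f t + g t).
Proof.
move=> [mf bf] [mg bg]; split; first exact: measurable_funD.
move=> c; have [M fM] := bf c; have [N gN] := bg c; exists (M + N) => t ct.
by rewrite (le_trans (ler_normD _ _))// lerD// ?fM ?gN.
Qed.

Lemma tameM n (f g : point n -> R) :
  tame f -> tame g -> tame (fun t => f t * g t).
Proof.
move=> [mf bf] [mg bg]; split; first exact: measurable_funM.
move=> c; have [M fM] := bf c; have [N gN] := bg c; exists (M * N) => t ct.
by rewrite normrM ler_pM// ?fM ?gN.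
Qed.

Lemma tameN n (f : point n -> R) : tame f -> tame (fun t => - f t).
Proof.
move=> tf; under [X in tame X]eq_fun do rewrite -mulN1r.
by apply: tameM => //; exact: tame_cst.
Qed.

Lemma tame_sum n (I : Type) (s : seq I) (F : I -> point n -> R) :
  (forall i, tame (F i)) -> tame (fun t => \sum_(i <- s) F i t).
Proof.
move=> tF; elim: s => [|i s IHs].
  by under [X in tame X]eq_fun do rewrite big_nil; exact: tame_cst.
by under [X in tame X]eq_fun do rewrite big_cons; exact: tameD.
Qed.

Lemma tame_prod n (I : Type) (s : seq I) (F : I -> point n -> R) :
  (forall i, tame (F i)) -> tame (fun t => \prod_(i <- s) F i t).
Proof.
move=> tF; elim: s => [|i s IHs].
  by under [X in tame X]eq_fun do rewrite big_nil; exact: tame_cst.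
by under [X in tame X]eq_fun do rewrite big_cons; exact: tameM.
Qed.

Lemma tameX n (f : point n -> R) m : tame f -> tame (fun t => f t ^+ m).
Proof.
move=> tf; elim: m => [|m IHm].
  by under [X in tame X]eq_fun do rewrite expr0; exact: tame_cst.
by under [X in tame X]eq_fun do rewrite exprS; exact: tameM.
Qed.

Lemma normsq_ge0 n (t : point n) : 0 <= normsq t.
Proof. by apply: sumr_ge0 => i _; exact: sqr_ge0. Qed.

Lemma sqr_le_normsq n (t : point n) i : (tnth t i : R) ^+ 2 <= normsq t.
Proof.
rewrite /normsq (bigD1 i)//= lerDl.
by apply: sumr_ge0 => j _; exact: sqr_ge0.
Qed.

Lemma rball_norm_le n (c : R) (t : point n) i :
  rball c t -> `|tnth t i : R| <= 1 + `|c|.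
Proof.
move=> ct; have c0 : 0 <= c by exact: le_trans (normsq_ge0 t) ct.
have ti := le_trans (sqr_le_normsq t i) ct.
rewrite (ger0_norm c0) -ler_sqr ?nnegrE ?addr_ge0// real_normK ?num_real//.
by apply: le_trans ti _; nra.
Qed.

Lemma tame_tnth n (i : 'I_n) : tame (fun t : point n => tnth t i : R).
Proof.
split; first exact: measurable_tnth.
by move=> c; exists (1 + `|c|) => t; exact: rball_norm_le.
Qed.

Lemma tame_normsq n : tame (@normsq R n).
Proof. by apply: tame_sum => i; apply: tameX; exact: tame_tnth. Qed.

Lemma tame_horner n (i : 'I_n) (p : {poly R}) :
  tame (fun t : point n => p.[tnth t i : R]).
Proof.
under [X in tame X]eq_fun do rewrite horner_coef.
apply: tame_sum => j; apply: tameM; first exact: tame_cst.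
by apply: tameX; exact: tame_tnth.
Qed.

Lemma tame_meval n (p : {mpoly R[n]}) :
  tame (fun t : point n => p.@[tnth t]).
Proof.
under [X in tame X]eq_fun do rewrite mevalE.
apply: tame_sum => m; apply: tameM; first exact: tame_cst.
by apply: tame_prod => i; apply: tameX; exact: tame_tnth.
Qed.

Lemma measurable_rball n (c : R) : measurable (@rball n c).
Proof.
have [mN _] := @tame_normsq n.
rewrite (_ : rball c = [set: point n] `&` (@normsq R n) @^-1` `]-oo, c]).
  exact: mN.
by apply/seteqP; split => t; rewrite /rball/= in_itv/= => // -[].
Qed.

Lemma measurable_box n (A : 'I_n -> set (measurableTypeR R)) :
  (forall i, measurable (A i)) ->
  measurable [set t : point n | forall i, A i (tnth t i)].
Proof.
move=> mA; rewrite (_ : [set t | _] = \bigcap_(i in [set: 'I_n])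
    ((fun t : point n => tnth t i) @^-1` A i)).
  apply: fin_bigcap_measurable => // i _.
  by rewrite -[X in measurable X]setTI; exact: measurable_tnth.
by apply/seteqP; split => [t At i _|t At i]; [exact: At|exact: (At i I)].
Qed.

(** The ball lies in a box, whose measure is a finite product of lengths. *)
Lemma rball_finite n (c : R) : (lebesgue_tuple R n (@rball n c) < +oo)%E.
Proof.
pose A (i : 'I_n) : set (measurableTypeR R) :=
  [set` `[- (1 + `|c|), 1 + `|c|]].
have mA i : measurable (A i) by exact: measurable_itv.
have mbox : measurable [set t : point n | forall i, A i (tnth t i)].
  exact: measurable_box.
apply: le_lt_trans (_ : (lebesgue_tuple R n [set t | forall i, A i (tnth t i)] < +oo)%E).
  apply: le_measure; rewrite ?inE//; first exact: measurable_rball.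
  by move=> t ct i; rewrite /A/= in_itv/= -ler_norml; exact: rball_norm_le.
rewrite lebesgue_tuple_box//.
suff /fineK <- : (\prod_(i < n) (@lebesgue_measure R (A i)))%E \is a fin_num.
  by rewrite ltry.
apply: (big_ind (fun x : \bar R => x \is a fin_num)) => //; first by move=> x y; exact: fin_numM.
move=> i _; rewrite /A lebesgue_measure_itv/=.
by case: ifP => // _; rewrite -EFinB.
Qed.

Lemma tame_integrable n (c : R) (f : point n -> R) : tame f ->
  (lebesgue_tuple R n).-integrable (rball c) (EFin \o f).
Proof.
move=> [mf bf]; apply: measurable_bounded_integrable.
- exact: measurable_rball.
- exact: rball_finite.
- exact: measurable_funTS.
- have [M fM] := bf c; exists M; split; first exact: num_real.
  by move=> x Mx t ct; exact: le_trans (fM t ct) (ltW Mx).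
Qed.

End TameFunctions.

(** * Slices of balls *)

Section Slicing.
Context (R : realType).
Local Notation point n := (n.-tuple (measurableTypeR R)).

Lemma normsq_cons n (x : R) (t : point n) :
  normsq (Defs.cons_tuple (x, t)) = x ^+ 2 + normsq t.
Proof.
rewrite /normsq big_ord_recl; congr (_ + _).
by apply: eq_bigr => i _; rewrite tnthS.
Qed.

Lemma rball_cons n (c x : R) (t : point n) :
  rball c (Defs.cons_tuple (x, t)) <-> rball (c - x ^+ 2) t.
Proof. by rewrite /rball/= normsq_cons lerBrDl. Qed.

(** Extension by zero, so that Fubini's theorem applies on the whole space. *)
Definition ballfun n (c : R) (f : point n -> R) : point n -> \bar R :=
  (EFin \o f) \_ (rball c).

Lemma measurable_ballfun n (c : R) (f : point n -> R) : tame f ->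
  measurable_fun [set: point n] (ballfun c f).
Proof.
move=> [mf _]; apply/(measurable_restrictT _ _).1; first exact: measurable_rball.
by apply: measurable_funTS; exact/measurable_EFinP.
Qed.

Lemma ballfun_cons_integrable n (c : R) (f : point n.+1 -> R) : tame f ->
  (@lebesgue_measure R \x lebesgue_tuple R n)%E.-integrable setT
    (ballfun c f \o @Defs.cons_tuple R n).
Proof.
move=> [mf bf].
have mpre : measurable (@Defs.cons_tuple R n @^-1` (rball c)).
  by rewrite -[X in measurable X]setTI; apply: measurable_cons_tuple => //; exact: measurable_rball.
rewrite (_ : ballfun c f \o _ =
   (EFin \o (f \o @Defs.cons_tuple R n)) \_ (@Defs.cons_tuple R n @^-1` (rball c))).
  apply/(integrable_mkcond (EFin \o (f \o @Defs.cons_tuple R n)) mpre).1.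
  apply: measurable_bounded_integrable => //.
  - exact: (@rball_finite R n.+1 c).
  - apply: measurable_funTS.
    exact: (measurableT_comp mf (@measurable_cons_tuple R n)).
  - have [M fM] := bf c; exists M; split; first exact: num_real.
    by move=> x Mx t ct; exact: le_trans (fM _ ct) (ltW Mx).
by apply/funext => z.
Qed.

Lemma integral_ball_cons n (c : R) (f : point n.+1 -> R) : tame f ->
  (\int[lebesgue_tuple R n.+1]_(t in rball c) (f t)%:E =
   \int[@lebesgue_measure R \x lebesgue_tuple R n]_z
      (ballfun c f \o @Defs.cons_tuple R n) z)%E.
Proof.
move=> tf; rewrite integral_mkcond.
rewrite (@integral_pushforward _ _ _ _ _ _ (@measurable_cons_tuple R n)
  (@lebesgue_measure R \x lebesgue_tuple R n)%E setT (ballfun c f)).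
- by rewrite preimage_setT.
- exact: measurable_ballfun.
- by rewrite preimage_setT; exact: ballfun_cons_integrable.
- by [].
Qed.

(** Fubini's theorem for the first coordinate against the others, in both
    orders: the outer variable is the first coordinate here, and the point
    formed by the other ones in [integral_ball_fiber]. *)
Lemma integral_ball_slice n (c : R) (f : point n.+1 -> R) : tame f ->
  (\int[lebesgue_tuple R n.+1]_(t in rball c) (f t)%:E =
   \int[@lebesgue_measure R]_x
     \int[lebesgue_tuple R n]_(t in rball (c - x ^+ 2)) (f (Defs.cons_tuple (x, t)))%:E)%E.
Proof.
move=> tf; rewrite integral_ball_cons//.
rewrite -integral12_prod_meas1; last exact: ballfun_cons_integrable.
apply: eq_integral => x _; rewrite /fubini_F [RHS]integral_mkcond.
apply: eq_integral => t _; rewrite /ballfun/= !patchE.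
by congr (if _ then _ else _); apply/idP/idP; rewrite !inE => /rball_cons.
Qed.

Lemma integral_ball_fiber n (c : R) (f : point n.+1 -> R) : tame f ->
  (\int[lebesgue_tuple R n.+1]_(t in rball c) (f t)%:E =
   \int[lebesgue_tuple R n]_t
     \int[@lebesgue_measure R]_(x in [set x : R | (x ^+ 2 <= c - normsq t)%R])
        (f (Defs.cons_tuple (x, t)))%:E)%E.
Proof.
move=> tf; rewrite integral_ball_cons//.
rewrite -integral21_prod_meas1; last exact: ballfun_cons_integrable.
apply: eq_integral => t _; rewrite /fubini_G [RHS]integral_mkcond.
apply: eq_integral => x _; rewrite /ballfun/= !patchE.
by congr (if _ then _ else _); apply/idP/idP;
  rewrite !inE /rball/= normsq_cons lerBrDr.
Qed.

(** The primitive vanishes at both ends of the interval, and the interval is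
    a point or empty when c is not positive. *)
Lemma integral_deriv_vanishing (c : R) (p : {poly R}) :
  (\int[@lebesgue_measure R]_(x in [set x : R | (x ^+ 2 <= c)%R])
     ((p * (c%:P - 'X^2))^`().[x])%:E = 0)%E.
Proof.
set q := p * _.
have [c0|c0] := leP c 0.
  rewrite (_ : [set x : R | _] = (if c == 0 then [set 0%R] else set0)).
    by case: ifP => _; rewrite ?integral_set0 ?integral_set1.
  apply/seteqP; split => x /=.
    move=> xc; have x0 : x = 0.
      by apply/eqP; rewrite -sqrf_eq0 -(rwP eqP); apply/eqP; rewrite eq_le sqr_ge0 (le_trans xc).
    by move: xc; rewrite x0 expr0n/= => c0'; rewrite (_ : c == 0) // eq_le c0 c0'.
  by case: ifP => [/eqP -> /= ->|//]; rewrite expr0n.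
have s0 : 0 < Num.sqrt c by rewrite sqrtr_gt0.
have sc : Num.sqrt c ^+ 2 = c by rewrite sqr_sqrtr// ltW.
rewrite (_ : [set x : R | _] = [set` `[- Num.sqrt c, Num.sqrt c]]); last first.
  apply/seteqP; split => x /=; rewrite in_itv/= -ler_norml.
    by move=> xc; rewrite -sqrtr_sqr ler_sqrt// ltW.
  by move=> xc; rewrite -sc -(real_normK (num_real x)) ler_sqr ?nnegrE ?sqrtr_ge0.
rewrite (@continuous_FTC2 _ _ (horner q)).
- by rewrite /q !hornerE sqrrN sc subrr !mulr0 -EFinB subrr.
- by apply: (lt_trans _ s0); rewrite oppr_lt0.
- by apply: continuous_subspaceT => x; exact: continuous_horner.
- split.
  + by move=> x _; apply: derivable_horner.
  + by apply: cvg_at_right_filter; exact: continuous_horner.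
  + by apply: cvg_at_left_filter; exact: continuous_horner.
- by move=> x _; rewrite -derivE.
Qed.

End Slicing.

(** * A divergence theorem on balls *)

Section Divergence.
Context (R : realType).
Local Notation point n := (n.-tuple (measurableTypeR R)).

(** Products of functions of one variable: these contain the monomials, and
    freezing a coordinate turns one into a scalar multiple of another. *)
Definition sepfun n (g : 'I_n -> {poly R}) (t : point n) : R :=
  \prod_(i < n) (g i).[tnth t i : R].

Definition deriv_at n (i : 'I_n) (g : 'I_n -> {poly R}) : 'I_n -> {poly R} :=
  fun l => if l == i then (g l)^`() else g l.

(** The value at t of the i-th partial derivative of g (c - |x|^2). *)
Definition sepdiv n (c : R) (i : 'I_n) (g : 'I_n -> {poly R}) (t : point n) : R :=
  sepfun (deriv_at i g) t * (c - normsq t) - 2 * (tnth t i : R) * sepfun g t.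

Lemma tame_sepfun n (g : 'I_n -> {poly R}) : tame (sepfun g).
Proof. by apply: tame_prod => i; exact: tame_horner. Qed.

Lemma tame_sepdiv n (c : R) (i : 'I_n) (g : 'I_n -> {poly R}) :
  tame (sepdiv c i g).
Proof.
apply: tameD.
  apply: tameM; first exact: tame_sepfun.
  by apply: tameD; [exact: tame_cst|apply: tameN; exact: tame_normsq].
apply: tameN; apply: tameM; last exact: tame_sepfun.
by apply: tameM; [exact: tame_cst|exact: tame_tnth].
Qed.

Lemma sepfun_cons n (g : 'I_n.+1 -> {poly R}) (x : R) (t : point n) :
  sepfun g (Defs.cons_tuple (x, t)) =
  (g ord0).[x] * sepfun (fun i => g (lift ord0 i)) t.
Proof.
rewrite /sepfun big_ord_recl; congr (_ * _).
by apply: eq_bigr => i _; rewrite tnthS.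
Qed.

(** By induction on the dimension. For the first coordinate, integrate along
    it first: the inner integral is that of the derivative of a polynomial
    which vanishes at both ends. For any other coordinate, freeze the first
    one: the slice is a ball of squared radius c - x^2, on which the integrand
    is a multiple of one of the same kind. *)
Lemma integral_sepdiv n (c : R) (i : 'I_n) (g : 'I_n -> {poly R}) :
  (\int[lebesgue_tuple R n]_(t in rball c) (sepdiv c i g t)%:E = 0)%E.
Proof.
elim: n c i g => [|n IHn] c i g; first by case: i.
have tF := tame_sepdiv c i g.
have [j|] := unliftP ord0 i => ->; last first.
  rewrite integral_ball_fiber//; last exact: tame_sepdiv.
  rewrite (@eq_integral _ _ _ _ _ (cst 0%E)) ?integral0// => t _ /=.
  rewrite -[RHS](integral_deriv_vanishing (c - normsq t)
    (sepfun (fun i => g (lift ord0 i)) t *: g ord0)).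
  apply: eq_integral => x _; congr (_%:E).
  have -> : sepdiv c ord0 g (Defs.cons_tuple (x, t)) =
      ((g ord0)^`().[x] * (c - (x ^+ 2 + normsq t)) - 2 * x * (g ord0).[x]) *
      sepfun (fun i => g (lift ord0 i)) t.
    rewrite /sepdiv !sepfun_cons normsq_cons {1}/deriv_at eqxx.
    by rewrite [tnth _ _](_ : _ = x)//; ring.
  rewrite derivM derivZ derivB derivC derivXn !hornerE.
  by rewrite /=; ring.
rewrite integral_ball_slice//; last exact: tame_sepdiv.
rewrite (@eq_integral _ _ _ _ _ (cst 0%E)) ?integral0// => x _ /=.
set h := fun i => g (lift ord0 i).
under eq_integral => t _.
  have -> : sepdiv c (lift ord0 j) g (Defs.cons_tuple (x, t)) =
      (g ord0).[x] * sepdiv (c - x ^+ 2) j h t.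
    have -> : sepdiv c (lift ord0 j) g (Defs.cons_tuple (x, t)) =
        (g ord0).[x] * sepfun (fun l => deriv_at (lift ord0 j) g (lift ord0 l)) t *
        (c - (x ^+ 2 + normsq t)) - 2 * (tnth t j : R) * ((g ord0).[x] * sepfun h t).
      by rewrite /sepdiv !sepfun_cons normsq_cons tnthS.
    have -> : sepfun (fun l => deriv_at (lift ord0 j) g (lift ord0 l)) t =
        sepfun (deriv_at j h) t.
      by apply: eq_bigr => l _; rewrite /deriv_at (inj_eq lift_inj).
    by rewrite /sepdiv; ring.
  rewrite EFinM; over.
rewrite integralZl; last 2 first.
- exact: measurable_rball.
- by apply: tame_integrable; exact: tame_sepdiv.
by rewrite IHn mule0.
Qed.

End Divergence.

(** * Integration of polynomials over the unit ball *)

Section BallFunctional.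
Context (R : realType) (d : nat).
Local Notation point n := (n.-tuple (measurableTypeR R)).
Local Notation polyd := {mpoly R[d]}.
Local Notation u := (oneBnormsq R d).

Definition ball_integral (p : polyd) : R :=
  \int[lebesgue_tuple R d]_(t in @unit_ball R d) p.@[tnth t].

Lemma ball_integrable (p : polyd) : (lebesgue_tuple R d).-integrable
  (@unit_ball R d) (EFin \o (fun t : point d => p.@[tnth t])).
Proof. by apply: tame_integrable; exact: tame_meval. Qed.

Lemma ball_integralD (p q : polyd) :
  ball_integral (p + q) = ball_integral p + ball_integral q.
Proof.
rewrite -[RHS]RintegralD; [|exact: measurable_rball|exact: ball_integrable..].
by apply: eq_Rintegral => t _; rewrite mevalD.
Qed.

Lemma ball_integralZ (a : R) (p : polyd) :
  ball_integral (a *: p) = a * ball_integral p.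
Proof.
rewrite -[RHS]RintegralZl; [|exact: measurable_rball|exact: ball_integrable].
by apply: eq_Rintegral => t _; rewrite mevalZ.
Qed.

Lemma ball_integral_is_linear : linear_for *%R ball_integral.
Proof. by move=> a p q; rewrite ball_integralD ball_integralZ. Qed.

HB.instance Definition _ :=
  GRing.isLinear.Build R polyd R *%R ball_integral ball_integral_is_linear.

Lemma ball_integralE (p : polyd) :
  (\int[lebesgue_tuple R d]_(t in @unit_ball R d) (p.@[tnth t])%:E =
   (ball_integral p)%:E)%E.
Proof.
rewrite /ball_integral /Rintegral fineK//.
by apply: integrable_fin_num; [exact: measurable_rball|exact: ball_integrable].
Qed.

Lemma meval_oneBnormsq (t : point d) : u.@[tnth t] = 1 - normsq t.
Proof.
rewrite /oneBnormsq mevalB meval1 (raddf_sum (meval (tnth t))); congr (_ - _).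
by apply: eq_bigr => i _; rewrite /= expr2 mevalM mevalXU.
Qed.

Lemma mderiv_X (i : 'I_d) : ('X_i : polyd)^`M(i) = 1.
Proof.
rewrite mderivX mnmE eqxx scale1r (_ : (U_(i) - U_(i) = 0)%MM) ?mpolyX0//.
by apply/mnmP => l; rewrite !mnmE subnn.
Qed.

Lemma mderiv_oneBnormsq (i : 'I_d) : u^`M(i) = - (2%:R *: 'X_i).
Proof.
rewrite /oneBnormsq mderivB -[1 in LHS]mpolyC1 mderivC sub0r; congr (- _).
rewrite (raddf_sum (mderiv i)) (bigD1 i)//= big1 ?addr0 => [|j ji].
  by rewrite /= expr2 mderivM mderiv_X mul1r mulr1 -mulr2n scaler_nat.
by rewrite /= expr2 mderivM mderivX mnmE (negPf ji) scale0r mul0r mulr0 addr0.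
Qed.

(** Gauss's theorem without a boundary term, the field h u being zero on the
    sphere. Both sides are linear in h, and for a monomial h this is
    [integral_sepdiv]. *)
Lemma ball_integral_mderiv_vanishing (i : 'I_d) (h : polyd) :
  ball_integral (h * u)^`M(i) = 0.
Proof.
rewrite (mpolyE h) mulr_suml (raddf_sum (mderiv i)) (raddf_sum ball_integral) big1 => [//|m _].
rewrite /= -scalerAl mderivZ ball_integralZ.
rewrite (_ : ball_integral _ = 0) ?mulr0//; apply/eqP; rewrite -eqe -ball_integralE.
apply/eqP; rewrite -[RHS](@integral_sepdiv R d 1 i (fun l => 'X^(m l))).
apply: eq_integral => t _; congr (_%:E).
rewrite mderivM mderiv_oneBnormsq mderivX mevalD !mevalM mevalZ mevalN mevalZ.
rewrite mevalXU meval_oneBnormsq !mevalX /sepdiv /sepfun /deriv_at.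
rewrite mulrN; congr (_ * _ - _).
  rewrite (bigD1 i)//= [in RHS](bigD1 i)//= eqxx derivXn hornerMn hornerXn.
  rewrite mnmE mnmE eqxx subn1 mulrA mulr_natl; congr (_ * _).
  apply: eq_bigr => l li; rewrite (negPf li) hornerXn mnmE mnmE.
  by rewrite eq_sym (negPf li) subn0.
by rewrite mulrC; congr (_ * _); apply: eq_bigr => l _; rewrite hornerXn.
Qed.

End BallFunctional.

(** * Positivity of the inner product *)

Section Kronecker.
Context (R : realType).

(** Kronecker's substitution x_i := s^(N^i) turns x^m into s^(kron N m). *)
Definition kron n (N : nat) (m : 'I_n -> nat) : nat := (\sum_(i < n) m i * N ^ i)%N.

Lemma kron_inj n (N : nat) (m m' : 'I_n -> nat) :
  (forall i, m i < N)%N -> (forall i, m' i < N)%N ->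
  kron N m = kron N m' -> m =1 m'.
Proof.
elim: n m m' => [|n IHn] m m' mN m'N; first by move=> _ [].
have step (f : 'I_n.+1 -> nat) :
    kron N f = (kron N (fun i => f (lift ord0 i)) * N + f ord0)%N.
  rewrite /kron big_ord_recl expn0 muln1 addnC; congr (_ + _)%N.
  by rewrite big_distrl/=; apply: eq_bigr => i _; rewrite expnSr mulnA.
rewrite !step => E.
have N0 : (0 < N)%N by exact: leq_ltn_trans (mN ord0).
have E0 : m ord0 = m' ord0.
  by have := congr1 (modn^~ N) E; rewrite !modnMDl !modn_small.
have E1 := congr1 (divn^~ N) E; rewrite /= !divnMDl// !divn_small// !addn0 in E1.
move=> i; have [j ->|->//] := unliftP ord0 i.
exact: (IHn _ _ (fun i => mN (lift ord0 i)) (fun i => m'N (lift ord0 i)) E1).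
Qed.

(** On the curve s |-> (s^(N^i))_i with N large, distinct monomials of p
    become distinct powers of s, so p restricts to a nonzero polynomial in s,
    which has a nonroot among the numbers a / (j + 1). *)
Lemma mpoly_neq0_small n (p : {mpoly R[n]}) (e : R) : p != 0 -> 0 < e ->
  exists v : 'I_n -> R, (forall i, 0 <= v i <= e) /\ p.@[v] != 0.
Proof.
move=> p0 e0; pose N := (msize p).+1.
pose q : {poly R} := \sum_(m <- msupp p) p@_m *: 'X^(kron N m).
have qE s : q.[s] = p.@[fun i => s ^+ (N ^ i)].
  rewrite /q horner_sum mevalE; apply: eq_bigr => m _.
  rewrite hornerZ hornerXn; congr (_ * _).
  by rewrite /kron expr_sum; apply: eq_bigr => i _; rewrite mulnC exprM.
have q0 : q != 0.
  have [m mp] : exists m, m \in msupp p.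
    by exists (mlead p); exact: mlead_supp.
  apply: contraTneq mp => /(congr1 (fun r : {poly R} => r`_(kron N m))).
  rewrite coef0 /q coef_sum => H; apply/negP => mp.
  move: H; rewrite (bigD1_seq m) ?msupp_uniq//= coefZ coefXn eqxx mulr1.
  rewrite big_seq_cond big1 ?addr0; first by apply/eqP; rewrite mcoeff_eq0 negbK.
  move=> m' /andP[m'p m'm]; rewrite coefZ coefXn.
  case: eqP => [E|_]; last by rewrite mulr0.
  have bnd (m1 : 'X_{1..n}) : m1 \in msupp p -> forall i, (m1 i < N)%N.
    move=> m1p i; rewrite ltnS (leq_trans _ (ltnW (msize_mdeg_lt m1p)))//.
    by rewrite mdegE (bigD1 i)//= leq_addr.
  by move: m'm; rewrite (_ : m' = m) ?eqxx//; apply/mnmP; exact: kron_inj (bnd _ m'p) (bnd _ mp) (esym E).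
pose a := Num.min e 1.
have a0 : 0 < a by rewrite /a lt_min e0 ltr01.
pose rs := [seq a / j.+1%:R | j <- iota 0 (size q)].
have [/allP rq|] := boolP (all (root q) rs).
  suff : q = 0 by move/eqP; rewrite (negPf q0).
  apply: (@roots_geq_poly_eq0 _ _ rs); [exact/allP| |by rewrite size_map size_iota].
  rewrite map_inj_uniq ?iota_uniq// => i j /(mulfI (lt0r_neq0 a0))/invr_inj/eqP.
  by rewrite eqr_nat => /eqP[].
rewrite -has_predC => /hasP[s /mapP[j _ ->]] /=.
set s' := a / _ => rs'; exists (fun i => s' ^+ (N ^ i)); split; last by rewrite -qE.
have s0 : 0 <= s' by rewrite divr_ge0// ltW.
have sa : s' <= a by rewrite ler_pdivrMr ?ltr0Sn// ler_peMr ?ler1n// ltW.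
have [s1 se] : s' <= 1 /\ s' <= e.
  by split; apply: le_trans sa _; rewrite ge_min lexx ?orbT.
move=> i; rewrite exprn_ge0//=; apply: le_trans se.
have : (0 < N ^ i)%N by rewrite expn_gt0.
by case: (N ^ i)%N => // k _; rewrite exprS ler_piMr// exprn_ile1.
Qed.

End Kronecker.

Section Positivity.
Context (R : realType) (d : nat).
Local Notation point n := (n.-tuple (measurableTypeR R)).
Local Notation polyd := {mpoly R[d]}.
Local Notation u := (oneBnormsq R d).

Lemma meval_continuous (p : polyd) :
  continuous (fun v : 'rV[R]_d => p.@[fun i => v ord0 i]).
Proof.
move=> v; have ext (f g : 'rV[R]_d -> R) :
    f =1 g -> {for v, continuous g} -> {for v, continuous f}.
  by move=> /funext ->.
elim/mpolyind: p => [|c m p mp c0 IHp].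
  by apply: (ext _ (cst 0)) => [w|]; [rewrite meval0|exact: cst_continuous].
apply: (ext _ (fun w => c * \prod_(i < d) w ord0 i ^+ m i + p.@[fun i => w ord0 i])).
  by move=> w; rewrite mevalD mevalZ mevalX.
apply: continuousD => //; apply: continuousM; first exact: cst_continuous.
elim: (index_enum _) => [|i s IHs].
  by apply: (ext _ (cst 1)) => [w|]; [rewrite big_nil|exact: cst_continuous].
apply: (ext _ (fun w => w ord0 i ^+ m i * \prod_(j <- s) w ord0 j ^+ m j)).
  by move=> w; rewrite big_cons.
apply: continuousM => //; elim: (m i) => [|j IHj].
  by apply: (ext _ (cst 1)) => [w|]; [rewrite expr0|exact: cst_continuous].
apply: (ext _ (fun w => w ord0 i * w ord0 i ^+ j)).
  by move=> w; rewrite exprS.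
by apply: continuousM => //; exact: coord_continuous.
Qed.

(** [mpoly_neq0_small] gives a suitable point inside the ball, and continuity a
    box around it. *)
Lemma neq0_on_box (p : polyd) : p != 0 ->
  exists (v : 'I_d -> R) (e : R), 0 < e /\ forall t : point d,
    (forall i, v i - e <= tnth t i <= v i + e) ->
    p.@[tnth t] != 0 /\ 0 < u.@[tnth t].
Proof.
move=> p0; pose a : R := d.+1%:R^-1.
have a0 : 0 < a by rewrite invr_gt0 ltr0Sn.
have [v [va pv]] := mpoly_neq0_small p0 a0.
pose V : 'rV[R]_d := \row_i v i.
have Vv : (fun i => V ord0 i) =1 v by move=> i; rewrite mxE.
have uv : 0 < u.@[v].
  have -> : u.@[v] = u.@[tnth (mktuple v)].
    by apply: meval_eq => i; rewrite tnth_mktuple.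
  rewrite meval_oneBnormsq subr_gt0 /normsq.
  apply: (@le_lt_trans _ _ (\sum_(i < d) a)).
    apply: ler_sum => i _; rewrite tnth_mktuple; have /andP[vi0 via] := va i.
    have a1 : a <= 1 by rewrite invf_le1// ?ltr0Sn// ler1n.
    by nra.
  rewrite sumr_const card_ord -mulr_natl /a ltr_pdivrMr ?ltr0Sn// mul1r.
  by rewrite ltr_nat.
have near_p : \forall w \near V, p.@[fun i => (w : 'rV[R]_d) ord0 i] != 0.
  apply: (cvgr_neq0 _ (@meval_continuous p V)).
  by rewrite (meval_eq _ Vv).
have near_u : \forall w \near V, 0 < u.@[fun i => (w : 'rV[R]_d) ord0 i].
  apply: (cvgr_gt _ (@meval_continuous u V)).
  by rewrite (meval_eq _ Vv).
have [e /= e0 He] : exists2 e : R, 0 < e & ball V e `<=`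
    [set w : 'rV[R]_d | p.@[fun i => w ord0 i] != 0 /\ 0 < u.@[fun i => w ord0 i]].
  by apply/nbhs_ballP; near=> w; split; near: w.
exists v, (e / 2); split; first by rewrite divr_gt0.
move=> t tv; pose w : 'rV[R]_d := \row_i tnth t i.
have wt : (fun i => w ord0 i) =1 tnth t by move=> i; rewrite mxE.
have := He w; rewrite /= !(meval_eq _ wt); apply.
split=> // i j; rewrite ord1 /ball/= !mxE.
have /andP[t1 t2] := tv j.
rewrite ltr_norml; apply/andP; split; lra.
Unshelve. all: by end_near. Qed.

(** Positive definiteness: a nonnegative integrand with zero integral vanishes
    almost everywhere, hence somewhere on any box, and not on the box of
    [neq0_on_box]. *)
Lemma ball_integral_sqr_eq0 (k : nat) (p : polyd) :
  ball_integral (p * p * u ^+ k) = 0 -> p = 0.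
Proof.
move=> I0; apply: contrapT => /eqP p0.
have [v [e [e0 Hv]]] := neq0_on_box p0.
pose A (i : 'I_d) : set (measurableTypeR R) := [set` `[v i - e, v i + e]].
pose B : set (point d) := [set t | forall i, A i (tnth t i)].
have mA i : measurable (A i) by exact: measurable_itv.
have mB : measurable B by exact: measurable_box.
have BH t : B t -> p.@[tnth t] != 0 /\ 0 < u.@[tnth t].
  by move=> Bt; apply: Hv => i; have := Bt i; rewrite /A/= in_itv.
have B_gt0 : (0 < lebesgue_tuple R d B)%E.
  rewrite lebesgue_tuple_box//.
  rewrite (eq_bigr (fun _ => (e *+ 2)%:E)); last first.
    move=> i _; rewrite /A lebesgue_measure_itv/= lte_fin ifT; last by lra.
    by rewrite -EFinB; congr (_%:E); rewrite mulr2n; ring.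
  by rewrite prodEFin lte_fin prodr_gt0// => i _; rewrite mulrn_wgt0.
have ge0 (t : point d) : unit_ball t -> 0 <= (p * p * u ^+ k).@[tnth t].
  move=> t1; rewrite !mevalM rmorphXn/= mulr_ge0//; first by rewrite -expr2 sqr_ge0.
  by rewrite exprn_ge0// meval_oneBnormsq subr_ge0.
have /ae_eq_integral_abs : (\int[lebesgue_tuple R d]_(t in @unit_ball R d)
    `|(p * p * u ^+ k).@[tnth t]%:E| = 0)%E.
  rewrite -[RHS]/(0%:E) -I0 -ball_integralE; apply: eq_integral => t.
  by rewrite inE => /ge0 t1; rewrite abse_EFin ger0_norm.
case=> //.
- exact: measurable_rball.
- apply/measurable_EFinP; apply: measurable_funTS.
  by have [] := tame_meval (p * p * u ^+ k).
move=> N [mN N0 BN].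
have : (lebesgue_tuple R d B <= lebesgue_tuple R d N)%E.
  apply: le_measure; rewrite ?inE// => t Bt; apply: BN => /= H.
  have [pt ut] := BH _ Bt.
  have t1 : unit_ball t by rewrite /unit_ball/= -subr_ge0 -meval_oneBnormsq ltW.
  have := H t1; rewrite !mevalM rmorphXn/= => /(congr1 fine)/= /eqP.
  by rewrite !mulf_eq0 expf_eq0 (gt_eqF ut) (negPf pt) andbF.
by rewrite N0 leNgt B_gt0.
Qed.

End Positivity.

Section InnerProduct.
Context (R : realType) (d k : nat).
Local Notation polyd := {mpoly R[d]}.
Local Notation u := (oneBnormsq R d).

Definition ip (p q : polyd) : R := ball_integral (p * q * u ^+ k).

(** On the ball, the real power with exponent k is the polynomial u^k. *)
Lemma ball_inner_nat (p q : polyd) : ball_inner k%:R p q = (ip p q)%:E.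
Proof.
rewrite /ip -ball_integralE; apply: eq_integral => t; rewrite inE => t1.
rewrite !mevalM rmorphXn/= meval_oneBnormsq /weight powR_mulrn//.
by rewrite subr_ge0.
Qed.

Lemma ipC p q : ip p q = ip q p.
Proof. by rewrite /ip [p * q]mulrC. Qed.

Lemma ip_is_linear p : linear_for *%R (ip p).
Proof.
move=> a q r; rewrite /ip mulrDr mulrDl linearD/=; congr (_ + _).
by rewrite -scalerAr -scalerAl linearZ.
Qed.

HB.instance Definition _ p := GRing.isLinear.Build R polyd R *%R (ip p) (ip_is_linear p).

Lemma ip_eq0 p : ip p p = 0 -> p = 0.
Proof. exact: ball_integral_sqr_eq0. Qed.

End InnerProduct.

(** * The differential operators *)

Section Operators.
Context (R : realType) (d : nat).
Local Notation polyd := {mpoly R[d]}.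
Local Notation u := (oneBnormsq R d).

Implicit Types p q : polyd.

Lemma euler_is_linear : linear (@euler R d).
Proof.
move=> a p q; rewrite /euler scaler_sumr -big_split; apply: eq_bigr => i _ /=.
by rewrite mderivD mderivZ mulrDr scalerAr.
Qed.

HB.instance Definition _ :=
  GRing.isLinear.Build R polyd polyd _ (@euler R d) euler_is_linear.

Lemma laplacian_is_linear : linear (@laplacian R d).
Proof.
move=> a p q; rewrite /laplacian scaler_sumr -big_split; apply: eq_bigr => i _ /=.
by rewrite !mderivD !mderivZ.
Qed.

HB.instance Definition _ :=
  GRing.isLinear.Build R polyd polyd _ (@laplacian R d) laplacian_is_linear.

Lemma Lop_is_linear mu : linear (@Lop R d mu).
Proof.
move=> a p q; rewrite /Lop !linearP/=.
rewrite -!mul_mpolyC; ring.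
Qed.

HB.instance Definition _ mu :=
  GRing.isLinear.Build R polyd polyd _ (@Lop R d mu) (@Lop_is_linear mu).

Definition grad_dot (p q : polyd) : polyd := \sum_(i < d) p^`M(i) * q^`M(i).

Lemma grad_dotC p q : grad_dot p q = grad_dot q p.
Proof. by apply: eq_bigr => i _; rewrite mulrC. Qed.

Lemma eulerM p q : euler (p * q) = euler p * q + p * euler q.
Proof.
rewrite /euler mulr_suml mulr_sumr -big_split; apply: eq_bigr => i _ /=.
by rewrite mderivM; ring.
Qed.

Lemma laplacianM p q :
  laplacian (p * q) = laplacian p * q + p * laplacian q + 2%:R * grad_dot p q.
Proof.
rewrite /laplacian /grad_dot mulr_suml !mulr_sumr -!big_split.
by apply: eq_bigr => i _ /=; rewrite mderivM mderivD !mderivM; ring.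
Qed.

Lemma sum_sqX : \sum_(i < d) 'X_i ^+ 2 = 1 - u :> polyd.
Proof. by rewrite /oneBnormsq; ring. Qed.

Lemma euler_u : euler u = 2%:R * u - 2%:R.
Proof.
rewrite /euler (eq_bigr (fun i => - (2%:R * ('X_i ^+ 2)))) => [|i _].
  by rewrite sumrN -mulr_sumr sum_sqX; ring.
by rewrite mderiv_oneBnormsq -mul_mpolyC rmorph_nat; ring.
Qed.

Lemma grad_dot_u p : grad_dot u p = - (2%:R * euler p).
Proof.
rewrite /grad_dot /euler mulr_sumr -sumrN; apply: eq_bigr => i _.
by rewrite mderiv_oneBnormsq -mul_mpolyC rmorph_nat; ring.
Qed.

Lemma laplacian_u : laplacian u = - (2 * d)%:R.
Proof.
rewrite /laplacian (eq_bigr (fun=> - 2%:R)) => [|i _].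
  by rewrite sumr_const card_ord mulNrn -mulrnA.
by rewrite mderiv_oneBnormsq mderivN mderivZ mderiv_X scaler_nat.
Qed.

Lemma eulerD p q : euler (p + q) = euler p + euler q.
Proof. exact: raddfD. Qed.

Lemma eulerB p q : euler (p - q) = euler p - euler q.
Proof. exact: raddfB. Qed.

Lemma eulerMn (v : nat) p : euler (v%:R * p) = v%:R * euler p.
Proof. by rewrite !mulr_natl raddfMn. Qed.

Lemma euler_uM (v : nat) p :
  euler (u ^+ v * p) = u ^+ v * (euler p + (2 * v)%:R * p) - (2 * v)%:R * u ^+ v.-1 * p.
Proof.
elim: v => [|v IHv]; first by rewrite expr0 !mul1r; ring.
rewrite exprS -mulrA eulerM IHv euler_u.
by case: v {IHv} => [|v]; rewrite /= ?exprS ?expr0; ring.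
Qed.

Lemma laplacian_uM (v : nat) p :
  laplacian (u ^+ v * p) = u ^+ v * laplacian p
    - (4 * v)%:R * u ^+ v.-1 * euler p
    - (4 * (v * v.-1) + 2 * d * v)%:R * u ^+ v.-1 * p
    + (4 * (v * v.-1))%:R * u ^+ v.-2 * p.
Proof.
elim: v => [|v IHv]; first by rewrite expr0 !mul1r; ring.
rewrite exprS -mulrA laplacianM IHv laplacian_u grad_dot_u euler_uM.
by case: v {IHv} => [|[|v]]; rewrite /= ?exprS ?expr0; ring.
Qed.

(** The coefficient of u^(v-2) cancels. The one of u^(v-1) vanishes for
    v = -mu, and then multiplication by u^v carries the operator of parameter
    -mu, up to a constant, to the one of parameter mu. *)
Lemma Lop_uM (mu : R) (v : nat) p :
  Lop mu (u ^+ v * p) =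
    u ^+ v * (Lop mu p - (4 * v)%:R *: euler p
              - ((4 * v * v)%:R + (2 * v)%:R * (2 * mu + d%:R)) *: p)
    + ((4 * v)%:R * (v%:R + mu)) *: (u ^+ v.-1 * p).
Proof.
rewrite /Lop laplacian_uM euler_uM eulerB -[(2 * v)%:R * _ * p]mulrA.
rewrite !eulerMn !euler_uM eulerD eulerMn -!mul_mpolyC.
case: v => [|[|v]]; rewrite /= ?exprS ?expr0.
- ring.
- ring.
- ring.
Qed.

End Operators.

(** * Degrees and homogeneous polynomials *)

Section Degrees.
Context (R : realType) (d : nat).
Local Notation polyd := {mpoly R[d]}.
Local Notation u := (oneBnormsq R d).
Implicit Types (p q : polyd) (n : nat).

Lemma msize_leP p n :
  reflect (forall m, m \in msupp p -> (mdeg m < n)%N) (msize p <= n)%N.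
Proof.
apply: (iffP idP) => [pn m mp|H]; first exact: leq_trans (msize_mdeg_lt mp) pn.
rewrite msizeE; elim: (msupp p) H => [|m s IHs] H; first by rewrite big_nil.
rewrite big_cons geq_max H ?mem_head// IHs// => m' m's.
by apply: H; rewrite inE m's orbT.
Qed.

Lemma msize_le0 p : (msize p <= 0)%N -> p = 0.
Proof. by rewrite leqn0 msize_poly_eq0 => /eqP. Qed.

Lemma msizeD_le_bound p q n :
  (msize p <= n -> msize q <= n -> msize (p + q) <= n)%N.
Proof.
move=> /msize_leP pn /msize_leP qn; apply/msize_leP => m /msuppD_le.
by rewrite mem_cat => /orP[/pn|/qn].
Qed.

Lemma msizeZ_le_bound p (a : R) n : (msize p <= n -> msize (a *: p) <= n)%N.
Proof. exact: leq_trans (msizeZ_le _ _). Qed.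

Lemma msizeB_le_bound p q n :
  (msize p <= n -> msize q <= n -> msize (p - q) <= n)%N.
Proof.
by move=> pn qn; apply: msizeD_le_bound => //; rewrite -scaleN1r msizeZ_le_bound.
Qed.

Lemma msize_sum_le_bound (I : Type) (s : seq I) (F : I -> polyd) n :
  (forall i, msize (F i) <= n)%N -> (msize (\sum_(i <- s) F i) <= n)%N.
Proof.
move=> Fn; elim: s => [|i s IHs]; first by rewrite big_nil msize0.
by rewrite big_cons msizeD_le_bound.
Qed.

Lemma msizeM_le_bound p q a b :
  (msize p <= a -> msize q <= b.+1 -> msize (p * q) <= a + b)%N.
Proof.
move=> pa qb; have [->|p0] := eqVneq p 0; first by rewrite mul0r msize0.
have [->|q0] := eqVneq q 0; first by rewrite mulr0 msize0.
by rewrite msizeM//; move: (leq_add pa qb); rewrite addnS; case: (msize p + _)%N.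
Qed.

Lemma dhomog_msize_le p n : p \is n.-homog -> (msize p <= n.+1)%N.
Proof. by move=> /dhomogP hp; apply/msize_leP => m /hp /= ->. Qed.

Lemma homog_msize_eq0 p n : p \is n.-homog -> (msize p <= n)%N -> p = 0.
Proof.
move=> /dhomogP hp /msize_leP pn; apply/eqP; rewrite -msupp_eq0.
case: (msupp p) hp pn => [//|m s] hp pn.
by have := pn m (mem_head _ _); rewrite [mdeg m]hp ?mem_head// ltnn.
Qed.

Lemma msize_sub_homog p n : (msize p <= n.+1)%N ->
  exists2 q, q \is n.-homog & (msize (p - q) <= n)%N.
Proof.
move=> pn; exists (pihomog mdeg n p); first exact: pihomogP.
rewrite {1}(pihomog_partitionE pn) big_ord_recr/= addrK.
by apply: msize_sum_le_bound => i; apply: leq_trans (dhomog_msize_le (pihomogP _ _ _)) _.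
Qed.

Lemma mdeg_subU (m : 'X_{1..d}) (i : 'I_d) :
  m i != 0%N -> mdeg m = (mdeg (m - U_(i))).+1.
Proof. by move=> mi; rewrite -{1}(@submK _ U_(i) m) ?lep1mP// mdegD mdeg1 addn1. Qed.

Lemma mderiv_msize p (i : 'I_d) n : (msize p <= n.+1)%N -> (msize p^`M(i) <= n)%N.
Proof.
move=> /msize_leP pn; rewrite (mpolyE p) (raddf_sum (mderiv i)) big_seq.
apply: (big_ind (fun q => (msize q <= n)%N)) => [|q r|m mp]; first by rewrite msize0.
  exact: msizeD_le_bound.
rewrite /= mderivZ mderivX; apply: msizeZ_le_bound.
have [->|mi] := eqVneq (m i) 0%N; first by rewrite scale0r msize0.
apply: msizeZ_le_bound; rewrite msizeX; move: (pn m mp).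
by rewrite (mdeg_subU mi).
Qed.

Lemma euler_msize p n : (msize p <= n)%N -> (msize (euler p) <= n)%N.
Proof.
case: n => [/msize_le0 ->|n pn]; first by rewrite raddf0 msize0.
apply: msize_sum_le_bound => i; rewrite mulrC -addn1.
by apply: msizeM_le_bound; rewrite ?mderiv_msize// msizeX mdeg1.
Qed.

Lemma laplacian_msize p n : (msize p <= n.+2)%N -> (msize (laplacian p) <= n)%N.
Proof.
by move=> pn; apply: msize_sum_le_bound => i; do 2! apply: mderiv_msize.
Qed.

Lemma Lop_msize mu p n : (msize p <= n)%N -> (msize (Lop mu p) <= n)%N.
Proof.
move=> pn; apply: msizeB_le_bound; last by apply: msizeZ_le_bound; exact: euler_msize.
apply: msizeB_le_bound; last by do 2! apply: euler_msize.
by apply: laplacian_msize; exact: leq_trans pn (leq_trans (leqnSn _) (leqnSn _)).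
Qed.

Lemma euler_homog p n : p \is n.-homog -> euler p = n%:R *: p.
Proof.
move=> /dhomogP hp; rewrite (mpolyE p) (raddf_sum (@euler R d)) scaler_sumr.
rewrite big_seq [RHS]big_seq; apply: eq_bigr => m mp /=.
rewrite linearZ/= scalerA mulrC -scalerA; congr (_ *: _).
rewrite -(hp m mp) /= mdegE natr_sum scaler_suml; apply: eq_bigr => i _.
rewrite mderivX -scalerAr -mpolyXD.
have [->|mi] := eqVneq (m i) 0%N; first by rewrite !scale0r.
by rewrite addmC submK// lep1mP.
Qed.

Lemma mderiv_homog p (i : 'I_d) n : p \is n.+1.-homog -> p^`M(i) \is n.-homog.
Proof.
move=> /dhomogP hp; rewrite (mpolyE p) (raddf_sum (mderiv i)) big_seq.
apply: rpred_sum => m mp; rewrite /= mderivZ mderivX; apply: rpredZ.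
have [->|mi] := eqVneq (m i) 0%N; first by rewrite scale0r rpred0.
apply: rpredZ; rewrite dhomogX; have := hp m mp; rewrite /= => /eqP.
by rewrite (mdeg_subU mi) eqSS.
Qed.

Lemma laplacian_homog p n : p \is n.+2.-homog -> laplacian p \is n.-homog.
Proof. by move=> hp; apply: rpred_sum => i _; do 2! apply: mderiv_homog. Qed.

(** The polynomial u - 1 is -|x|^2, the leading part of u. *)
Lemma u_expr_lead (v : nat) : (msize (u ^+ v - (u - 1) ^+ v) <= 2 * v)%N.
Proof.
have um : (msize u <= 3)%N.
  apply: msizeB_le_bound; first by rewrite msize1.
  by apply: msize_sum_le_bound => i; rewrite expr2; apply: (@msizeM_le_bound _ _ 2 1); rewrite msizeX mdeg1.
have u1m : (msize (u - 1) <= 3)%N by apply: msizeB_le_bound; rewrite ?msize1.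
have u1X w : (msize ((u - 1) ^+ w) <= (2 * w).+1)%N.
  elim: w => [|w IHw]; first by rewrite expr0 msize1.
  rewrite exprSr mulnS (_ : (2 + 2 * w).+1 = (2 * w).+1 + 2)%N; last by lia.
  exact: msizeM_le_bound.
elim: v => [|v IHv]; first by rewrite !expr0 subrr msize0.
rewrite !exprSr (_ : _ - _ = (u ^+ v - (u - 1) ^+ v) * u + (u - 1) ^+ v); last by ring.
apply: msizeD_le_bound; first by rewrite mulnS addnC; exact: msizeM_le_bound.
by apply: leq_trans (u1X v) _; lia.
Qed.

Lemma u1_homog : (u - 1) \is 2.-homog.
Proof.
rewrite (_ : u - 1 = - \sum_(i < d) 'X_i ^+ 2); last by rewrite sum_sqX; ring.
rewrite rpredN; apply: rpred_sum => i _.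
have Xi : ('X_i : polyd) \is 1.-homog by rewrite dhomogX /= mdeg1.
exact: (dhomogM Xi Xi).
Qed.

End Degrees.

(** * Orthogonal polynomials on the ball *)

Section SelfAdjoint.
Context (R : realType) (d : nat).
Local Notation polyd := {mpoly R[d]}.
Local Notation u := (oneBnormsq R d).
Implicit Types (p q : polyd) (n k : nat).

(* Deciding a convertibility between inner products would unfold integrals. *)
Opaque ball_integral.

Lemma mderiv_uX (i : 'I_d) (v : nat) :
  (u ^+ v.+1)^`M(i) = - (2 * v.+1)%:R * 'X_i * u ^+ v.
Proof.
elim: v => [|v IHv].
  by rewrite expr1 expr0 mderiv_oneBnormsq -mul_mpolyC rmorph_nat; ring.
rewrite exprS mderivM IHv mderiv_oneBnormsq -mul_mpolyC rmorph_nat exprS; ring.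
Qed.

(** In divergence form, W L_k p = div (W (grad p - x E p)) for the weight
    W = u^k, with E the Euler operator; here both sides are tested against q.
    The second term on the right is symmetric in p and q. *)
Lemma Lop_divergence k p q :
  \sum_(i < d) (q * u ^+ k.+1 * (p^`M(i) - 'X_i * euler p))^`M(i) =
  q * Lop k.+1%:R p * u ^+ k.+1
  + (grad_dot p q - euler p * euler q) * u ^+ k.+1.
Proof.
pose e := euler p.
rewrite (eq_bigr (fun i => u ^+ k.+1 * (p^`M(i) * q^`M(i)) - (u ^+ k.+1 * e) * ('X_i * q^`M(i))
   - ((2 * k.+1)%:R * q * u ^+ k) * ('X_i * p^`M(i))
   + ((2 * k.+1)%:R * q * u ^+ k * e) * 'X_i ^+ 2
   + q * u ^+ k.+1 * p^`M(i)^`M(i) - q * u ^+ k.+1 * e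
   - q * u ^+ k.+1 * ('X_i * e^`M(i)))); last first.
  by move=> i _; rewrite -/e !mderivM mderivB mderivM mderiv_X mderiv_uX exprS; ring.
rewrite !sumrB !big_split/= !sumrN -!mulr_sumr sumr_const card_ord.
rewrite -[_ *+ d]mulr_natl.
rewrite sum_sqX -/(grad_dot p q) -/(euler q) -/(euler p) -/(euler e) -/(laplacian p) /Lop -/e.
rewrite -!mul_mpolyC exprS; ring.
Qed.

(** The field in [Lop_divergence] has a factor u, so its divergence integrates
    to 0. *)
Lemma Lop_symmetric k p q :
  ip k.+1 q (Lop k.+1%:R p) = ip k.+1 p (Lop k.+1%:R q).
Proof.
have green r s : ip k.+1 s (Lop k.+1%:R r) =
    - ball_integral ((grad_dot r s - euler r * euler s) * u ^+ k.+1).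
  rewrite /ip; apply/eqP; rewrite -addr_eq0 -ball_integralD -Lop_divergence.
  rewrite (raddf_sum (@ball_integral R d)) big1//= => i _.
  by rewrite exprSr mulrA mulrAC ball_integral_mderiv_vanishing.
by rewrite !green grad_dotC [euler q * _]mulrC.
Qed.

Lemma orth_spaceP k n (Q : polyd) : orth_space k%:R n%:Z Q <->
  (msize Q <= n.+1)%N /\ forall q, (msize q <= n)%N -> ip k Q q = 0.
Proof.
split=> -[Qn Qq]; split=> // q qn; have := Qq q qn.
  by rewrite ball_inner_nat => -[].
by rewrite ball_inner_nat => ->.
Qed.

(** The difference S of the two sides has degree less than n, because L_k acts
    on the leading part through the Euler operator alone. It is orthogonal to
    all polynomials of degree less than n, because L_k is symmetric and does
    not raise degrees. So S is orthogonal to itself. *)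
Lemma orth_space_eigen k n (Q : polyd) :
  orth_space k.+1%:R n%:Z Q -> Lop k.+1%:R Q = lambda d k.+1%:R n *: Q.
Proof.
move=> /orth_spaceP[Qn Qorth]; apply/eqP; rewrite -subr_eq0; apply/eqP.
set S := _ - _.
have Sn : (msize S <= n)%N.
  have [T hT QTn] := msize_sub_homog Qn.
  have -> : S = (Lop k.+1%:R (Q - T) - lambda d k.+1%:R n *: (Q - T)) + laplacian T.
    rewrite /S linearB/= {3}/Lop (euler_homog hT) !linearZ/= (euler_homog hT).
    by rewrite /lambda -!mul_mpolyC; ring.
  apply: msizeD_le_bound.
    by apply: msizeB_le_bound; [exact: Lop_msize|exact: msizeZ_le_bound].
  by apply: laplacian_msize; exact: leq_trans (dhomog_msize_le hT) (leqnSn _).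
apply: (@ip_eq0 _ _ k.+1); rewrite {1}/S ipC raddfB/= linearZ/=.
by rewrite Lop_symmetric [ip _ S Q]ipC !Qorth ?mulr0 ?subrr// Lop_msize.
Qed.

(** The Gram-Schmidt process. That q lies in the span of s is expressed by its
    having every property that is closed under linear combinations and shared
    by the members of s. *)
Lemma orth_projection k p (s : seq polyd) :
  exists2 q, (forall P : polyd -> Prop, P 0 ->
      (forall a x y, P x -> P y -> P (a *: x + y)) ->
      (forall r, r \in s -> P r) -> P q) &
    forall r, r \in s -> ip k (p - q) r = 0.
Proof.
have orth_closed (x : polyd) a y z :
    ip k x y = 0 -> ip k x z = 0 -> ip k x (a *: y + z) = 0.
  by move=> xy xz; rewrite linearP/= xy xz mulr0 addr0.
elim: s p => [|v s IHs] p; first by exists 0.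
have [v1 v1s v1o] := IHs v; have [p1 p1s p1o] := IHs p.
have p1v1 : ip k (p - p1) v1 = 0.
  apply: (v1s (fun x => ip k (p - p1) x = 0)) => [|a x y|r]; last exact: p1o.
    by rewrite raddf0.
  exact: orth_closed.
have v1v1 : ip k (v - v1) v1 = 0.
  apply: (v1s (fun x => ip k (v - v1) x = 0)) => [|a x y|r]; last exact: v1o.
    by rewrite raddf0.
  exact: orth_closed.
pose w := v - v1.
have [w0|w0] := eqVneq w 0.
  exists p1 => [P P0 Pc Ps|r].
    by apply: (p1s P) => // r rs; apply: Ps; rewrite inE rs orbT.
  by rewrite inE => /orP[/eqP ->|/p1o//]; rewrite -(subrK v1 v) -/w w0 add0r.
pose c := ip k (p - p1) w / ip k w w.
have ww0 : ip k w w != 0 by apply: contra_neq w0; exact: ip_eq0.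
exists (c *: w + p1) => [P P0 Pc Ps|r].
  have Ps' r : r \in s -> P r by move=> rs; apply: Ps; rewrite inE rs orbT.
  apply: (Pc); last exact: (p1s P P0 Pc Ps').
  rewrite /w addrC -scaleN1r; apply: (Pc); first exact: (v1s P P0 Pc Ps').
  by apply: Ps; rewrite mem_head.
rewrite (_ : p - _ = (p - p1) - c *: w); last by rewrite opprD addrA addrAC.
rewrite ipC raddfB/= linearZ/= ![ip k r _]ipC inE => /orP[/eqP ->|rs]; last first.
  by rewrite p1o// v1o// mulr0 subrr.
have ipv x : ip k x v = ip k x w + ip k x v1 by rewrite -raddfD/= subrK.
rewrite !ipv p1v1 [ip k w v1]v1v1 !addr0.
by rewrite /c divfK// subrr.
Qed.

End SelfAdjoint.

(** * The eigenvalue equations *)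

Section Eigenfunctions.
Context (R : realType) (d : nat).
Local Notation polyd := {mpoly R[d]}.
Local Notation u := (oneBnormsq R d).
Implicit Types (p q : polyd) (n k m : nat).

Lemma harmonic_Lop_uM mu (v m : nat) (Y : polyd) :
  Y \is m.-homog -> laplacian Y = 0 ->
  Lop mu (u ^+ v * Y) = lambda d mu (m + 2 * v) *: (u ^+ v * Y)
    + ((4 * v)%:R * (v%:R + mu)) *: (u ^+ v.-1 * Y).
Proof.
move=> hY Y0; rewrite Lop_uM /Lop Y0 (euler_homog hY) linearZ/= (euler_homog hY).
by rewrite /lambda -!mul_mpolyC; ring.
Qed.

Lemma poch_neq0 (a : R) (j : nat) :
  (forall i, (i < j)%N -> a + i%:R != 0) -> poch a j != 0.
Proof.
by move=> H; rewrite /poch; apply/prodf_neq0 => i _; exact: H.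
Qed.

Lemma pochS (a : R) (j : nat) : poch a j.+1 = poch a j * (a + j%:R).
Proof. by rewrite /poch big_ord_recr. Qed.

Lemma poch_Nk_neq0 k j : (j < k)%N -> poch (- k%:R + 1 : R) j != 0.
Proof.
move=> jk; apply: poch_neq0 => i ij.
rewrite (_ : _ + _ = i.+1%:R - k%:R); last by ring.
by rewrite subr_eq0 eqr_nat; lia.
Qed.

(** The recursion that makes the sum of the terms a_v u^v Y an eigenfunction;
    the factor of a_v in it is a difference of two eigenvalues. It holds also
    when the last shifted factorial in the denominator of the
    coefficients is 0, all of them being 0 then. *)
Lemma coefa_rec k n j v : (v < j)%N -> (j < k)%N ->
  4 * (j - v)%:R * (n%:R - j%:R + v%:R - k%:R + d%:R / 2) * coefa R d k n j v
  + 4 * v.+1%:R * (v.+1%:R - k%:R) * coefa R d k n j v.+1 = 0.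
Proof.
move=> vj jk.
have pv : poch (- k%:R + 1 : R) v != 0 by apply: poch_Nk_neq0; lia.
have pv1 : (- k%:R + 1 + v%:R : R) != 0.
  have := @poch_Nk_neq0 k v.+1 ltac:(lia).
  by rewrite pochS mulf_eq0 negb_or => /andP[].
have [s ->] : exists s, j = (v + s.+1)%N by exists (j - v.+1)%N; lia.
rewrite /coefa [(v + s.+1 - v)%N]addKn.
rewrite (_ : (v + s.+1 - v.+1 = s)%N); last by lia.
rewrite !pochS !factS exprS !natrM.
have f1 : (v`!%:R : R) != 0 by rewrite pnatr_eq0 -lt0n fact_gt0.
have f2 : (s`!%:R : R) != 0 by rewrite pnatr_eq0 -lt0n fact_gt0.
have f3 : (v.+1%:R : R) != 0 by rewrite pnatr_eq0.
have f4 : (s.+1%:R : R) != 0 by rewrite pnatr_eq0.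
set D := poch _ (v + s.+1); set Q := poch _ v; set E := poch _ (v + s.+1).
(* E occurs in all the coefficients and may vanish: its inverse stays an atom. *)
rewrite !invfM; move: (E^-1) D Q => E' D Q; clear E.
move: (poch _ v) pv => pv' pv; field.
by rewrite pv1 pv f1 f2 -!mulrS f3 f4.
Qed.

(** By [harmonic_Lop_uM] the operator maps the span of the u^v Y to itself, with
    one term below the diagonal; the coefficient of u^v Y in the difference of
    the two sides is the left side of [coefa_rec]. *)
Lemma Lop_harmonic_sum k m j (Y : polyd) : (j < k)%N ->
  Y \is m.-homog -> laplacian Y = 0 ->
  Lop (- k%:R) ((\sum_(v < j.+1) coefa R d k (m + 2 * j) j v *: u ^+ v) * Y) =
  lambda d (- k%:R) (m + 2 * j) *:
    ((\sum_(v < j.+1) coefa R d k (m + 2 * j) j v *: u ^+ v) * Y).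
Proof.
move=> jk hY Y0; set n := (m + 2 * j)%N.
rewrite mulr_suml (raddf_sum (@Lop R d _)) scaler_sumr.
apply/eqP; rewrite -subr_eq0 -sumrB; apply/eqP.
rewrite (eq_bigr (fun v : 'I_j.+1 =>
   (coefa R d k n j v * (lambda d (- k%:R) (m + 2 * v) - lambda d (- k%:R) n)) *: (u ^+ v * Y)
 + (coefa R d k n j v * ((4 * v)%:R * (v%:R - k%:R))) *: (u ^+ v.-1 * Y))); last first.
  move=> v _ /=; move: (coefa R d k n j v) => a.
  rewrite -!scalerAl linearZ/= (harmonic_Lop_uM _ _ hY Y0).
  by rewrite -!mul_mpolyC -/n; ring.
rewrite big_split/= big_ord_recr/= [X in _ + X]big_ord_recl/=.
rewrite subrr mulr0 scale0r muln0 mul0r mulr0 scale0r addr0 add0r -big_split/=.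
apply: big1 => v _; rewrite /bump/= !add1n -scalerDl.
rewrite [X in X *: _](_ : _ = 0) ?scale0r//.
rewrite -[RHS](@coefa_rec k n j v)// /lambda natrB 1?ltnW//.
by rewrite /n !natrD !natrM; field.
Qed.

Lemma Lop_orth_eigen k m (Q : polyd) : orth_space k.+1%:R m%:Z Q ->
  Lop (- k.+1%:R) (u ^+ k.+1 * Q) =
  lambda d (- k.+1%:R) (m + 2 * k.+1) *: (u ^+ k.+1 * Q).
Proof.
move=> /orth_space_eigen LQ.
have LE : Lop (- k.+1%:R) Q = lambda d k.+1%:R m *: Q + (4 * k.+1)%:R *: euler Q.
  by rewrite -LQ /Lop -!mul_mpolyC; ring.
rewrite Lop_uM LE subrr mulr0 scale0r addr0 /lambda -!mul_mpolyC; ring.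
Qed.

Lemma harmonic_spaceP n j (Y : polyd) :
  harmonic_space (n%:Z - j%:Z) Y ->
  exists2 m, n = (m + j)%N & Y \is m.-homog /\ laplacian Y = 0.
Proof.
have [jn|nj] := leqP j n.
  by rewrite subzn//; exists (n - j)%N => //; rewrite subnK.
have -> : n%:Z - j%:Z = Negz (j - n).-1 by lia.
by [].
Qed.

Lemma orth_spaceB mu n j (Q : polyd) :
  orth_space mu (n%:Z - j%:Z) Q ->
  exists2 m, n = (m + j)%N & orth_space mu m%:Z Q.
Proof.
have [jn|nj] := leqP j n.
  by rewrite subzn//; exists (n - j)%N => //; rewrite subnK.
have -> : n%:Z - j%:Z = Negz (j - n).-1 by lia.
by [].
Qed.

Lemma Uset_eigen k n (P : polyd) : (0 < k)%N -> Uset k n P ->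
  Lop (- k%:R) P = lambda d (- k%:R) n *: P.
Proof.
move=> k0 [[[hP P0]|[j /andP[j1 jk]]]|].
- have := @harmonic_Lop_uM (- k%:R) 0 n P hP P0.
  by rewrite expr0 mul1r !muln0 mul0r scale0r addr0 addn0.
- move=> [Y /harmonic_spaceP[m -> [hY Y0]] <-].
  by apply: Lop_harmonic_sum => //; lia.
- case: k k0 => [//|k _] [Q /orth_spaceB[m -> VQ] <-].
  exact: Lop_orth_eigen.
Qed.

End Eigenfunctions.

(** * The Fischer decomposition *)

Section Fischer.
Context (R : realType) (d : nat).
Local Notation polyd := {mpoly R[d]}.
Local Notation u := (oneBnormsq R d).
Local Notation rho := (u - 1).
Implicit Types (p q r Y : polyd) (n : nat).

Lemma laplacian_rhoM q n : q \is n.-homog ->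
  laplacian (rho * q) = rho * laplacian q - (2 * d + 4 * n)%:R * q.
Proof.
move=> hq; rewrite mulrBl mul1r raddfB/= laplacianM laplacian_u grad_dot_u.
by rewrite (euler_homog hq) -mul_mpolyC rmorph_nat; ring.
Qed.

Lemma laplacian_lt2 p n : (n < 2)%N -> p \is n.-homog -> laplacian p = 0.
Proof.
move=> n2 hp; apply: msize_le0; apply: laplacian_msize.
exact: leq_trans (dhomog_msize_le hp) _.
Qed.

(** Solving rho (laplacian r) - c r = p amounts to finding s = laplacian r, which
    gives back r = (rho s - p) / c; and s solves an equation of the same form,
    with a larger constant, two degrees lower. *)
Lemma rho_laplacian_bij n (c : R) : 0 < c ->
  (forall p, p \is n.-homog ->
     exists2 r, r \is n.-homog & rho * laplacian r - c *: r = p) /\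
  (forall r, r \is n.-homog -> rho * laplacian r - c *: r = 0 -> r = 0).
Proof.
have [N] := ubnP n; elim: N n c => // N IHN n c; rewrite ltnS => nN c0.
have cN0 : c != 0 by rewrite gt_eqF.
have [n2|] := ltnP n 2.
  split=> [p hp|r hr].
    exists (- c^-1 *: p); first by rewrite rpredZ.
    rewrite (laplacian_lt2 n2) ?rpredZ// mulr0 sub0r scalerA mulrN mulfV//.
    by rewrite scaleN1r opprK.
  rewrite (laplacian_lt2 n2 hr) mulr0 sub0r => /eqP.
  by rewrite oppr_eq0 scaler_eq0 (negPf cN0) => /eqP.
case: n nN => [//|[//|n]] nN _.
have c'0 : 0 < c + (2 * d + 4 * n)%:R by rewrite ltr_wpDr.
have [exT injT] := IHN n _ ltac:(lia) c'0.
have step s : s \is n.-homog ->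
    laplacian (rho * s) = (rho * laplacian s - (c + (2 * d + 4 * n)%:R) *: s) + c *: s.
  by move=> hs; rewrite (laplacian_rhoM hs) -!mul_mpolyC; ring.
split=> [p hp|r hr r0].
  have [s hs sE] := exT _ (laplacian_homog hp).
  have hrs : rho * s - p \is n.+2.-homog.
    by rewrite rpredB// -[n.+2]add2n; apply: dhomogM => //; exact: u1_homog.
  exists (c^-1 *: (rho * s - p)); first by rewrite rpredZ.
  rewrite linearZ/= raddfB/= step// sE scalerA mulfV// scale1r.
  by rewrite [_ + c *: s]addrC addrK scalerA mulVf// scale1r opprB addrC subrK.
have s0 : laplacian r = 0.
  apply: injT; first exact: laplacian_homog.
  have rE : rho * laplacian r = c *: r by apply/eqP; rewrite -subr_eq0 r0.
  apply: (addIr (c *: laplacian r)).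
  by rewrite -step ?laplacian_homog// rE linearZ/= add0r.
move: r0; rewrite s0 mulr0 sub0r => /eqP.
by rewrite oppr_eq0 scaler_eq0 (negPf cN0) => /eqP.
Qed.

Lemma laplacian_rho_bij n : (0 < d)%N ->
  (forall p, p \is n.-homog -> exists2 r, r \is n.-homog & laplacian (rho * r) = p) /\
  (forall r, r \is n.-homog -> laplacian (rho * r) = 0 -> r = 0).
Proof.
move=> d0; have c0 : 0 < (2 * d + 4 * n)%:R :> R by rewrite ltr0n; lia.
have E r : r \is n.-homog -> laplacian (rho * r) =
    rho * laplacian r - (2 * d + 4 * n)%:R *: r.
  by move=> hr; rewrite (laplacian_rhoM hr) -mul_mpolyC rmorph_nat.
have [exT injT] := rho_laplacian_bij n c0.
split=> [p /exT[r hr rE]|r hr]; first by exists r; rewrite ?E.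
by rewrite E//; exact: injT.
Qed.

Lemma fischer_decomposition n p : (0 < d)%N -> p \is n.+2.-homog ->
  exists Y r, [/\ Y \is n.+2.-homog, laplacian Y = 0, r \is n.-homog & p = Y + rho * r].
Proof.
move=> d0 hp; have [exT _] := laplacian_rho_bij n d0.
have [r hr rE] := exT _ (laplacian_homog hp).
exists (p - rho * r), r; split => //; last by rewrite subrK.
  by rewrite rpredB// -[n.+2]add2n; apply: dhomogM => //; exact: u1_homog.
by rewrite raddfB/= rE subrr.
Qed.

Lemma fischer_unique n Y r : (0 < d)%N -> laplacian Y = 0 -> r \is n.-homog ->
  Y + rho * r = 0 -> r = 0.
Proof.
move=> d0 Y0 hr /(congr1 (@laplacian R d)); rewrite raddfD/= Y0 add0r raddf0.
by have [_] := laplacian_rho_bij n d0; exact.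
Qed.

End Fischer.

(** * Linear spans *)

Section LinearSpan.
Context (K : fieldType) (V : lmodType K).
Implicit Types (A : set V) (v w : V).

Lemma linspan_ind A (P : V -> Prop) : P 0 ->
  (forall a v w, P v -> P w -> P (a *: v + w)) -> (forall v, A v -> P v) ->
  forall v, linspan A v -> P v.
Proof.
move=> P0 Pc AP _ [s [c [sA ->]]].
elim: s sA => [|x s IHs] sA; first by rewrite big_nil.
rewrite big_cons; apply: Pc; first by apply/AP/sA; rewrite mem_head.
by apply: IHs => y ys; apply: sA; rewrite inE ys orbT.
Qed.

(** Rewrites sums over two lists as sums over a common list without
    repetitions, in which the coefficient of a vector can depend on it only. *)
Lemma sum_count (F : V -> V) (s t : seq V) : uniq t -> {subset s <= t} ->
  \sum_(x <- s) F x = \sum_(x <- t) F x *+ count_mem x s.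
Proof.
move=> ut; elim: s => [|x s IHs] st.
  by rewrite big_nil big1// => x _; rewrite mulr0n.
rewrite big_cons IHs => [|y ys]; last by apply: st; rewrite inE ys orbT.
under [RHS]eq_bigr => y _ do rewrite /= mulrnDr.
rewrite big_split/=; congr (_ + _).
rewrite (bigD1_seq x) ?st ?mem_head//= eqxx mulr1n big1 ?addr0// => y yx.
by rewrite eq_sym (negPf yx) mulr0n.
Qed.

Lemma linspan_closed A a v w :
  linspan A v -> linspan A w -> linspan A (a *: v + w).
Proof.
move=> [s [c [sA ->]]] [t [e [tA ->]]].
pose r := undup (s ++ t); have ur : uniq r by exact: undup_uniq.
exists r, (fun x => a * (c x *+ count_mem x s) + e x *+ count_mem x t); split.
  by move=> x; rewrite mem_undup mem_cat => /orP[/sA|/tA].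
rewrite (@sum_count _ s r)//; last by move=> x xs; rewrite mem_undup mem_cat xs.
rewrite (@sum_count _ t r)//; last by move=> x xt; rewrite mem_undup mem_cat xt orbT.
rewrite scaler_sumr -big_split; apply: eq_bigr => x _ /=.
by rewrite scalerDl !scalerMnl scalerA.
Qed.

Lemma linspan_sub A v : A v -> linspan A v.
Proof.
move=> Av; exists [:: v], (fun=> 1); split; last by rewrite big_seq1 scale1r.
by move=> x; rewrite inE => /eqP ->.
Qed.

Lemma linspan0 A : linspan A 0.
Proof. by exists [::], (fun=> 0); split; [|rewrite big_nil]. Qed.

Lemma linspan_sum A (I : eqType) (s : seq I) (F : I -> V) :
  (forall i, i \in s -> linspan A (F i)) -> linspan A (\sum_(i <- s) F i).
Proof.
elim: s => [|i s IHs] AF; first by rewrite big_nil; exact: linspan0.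
rewrite big_cons -[F i]scale1r; apply: linspan_closed.
  by apply: AF; rewrite mem_head.
by apply: IHs => j js; apply: AF; rewrite inE js orbT.
Qed.

Lemma linspanZ A a v : linspan A v -> linspan A (a *: v).
Proof. by move=> Av; rewrite -[_ *: _]addr0; apply: linspan_closed => //; exact: linspan0. Qed.

Lemma linspanB A v w : linspan A v -> linspan A w -> linspan A (v - w).
Proof. by move=> Av Aw; rewrite addrC -scaleN1r; apply: linspan_closed. Qed.

Lemma linfree_image (I : eqType) (f : I -> V) (D : set I) :
  (forall (s : seq I) (c : I -> K), uniq s -> (forall i, i \in s -> D i) ->
     \sum_(i <- s) c i *: f i = 0 -> forall i, i \in s -> c i = 0) ->
  linfree (f @` D).
Proof.
move=> ind s c us sD s0.
have [t [ut tD tE]] : exists t : seq I, [/\ uniq t, (forall i, i \in t -> D i) &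
    s = [seq f i | i <- t]].
  elim: s us sD {s0} => [|x s IHs]; first by exists [::].
  move=> /= /andP[xs us] sD.
  have [t [ut tD tE]] := IHs us (fun y ys => sD y (mem_behead (ys : y \in behead (x :: s)))).
  have [i Di fi] := sD x (mem_head _ _).
  exists (i :: t); split => //=; last by rewrite fi tE.
    by rewrite ut andbT; apply: contra xs => it; rewrite tE -fi map_f.
  by move=> j; rewrite inE => /orP[/eqP ->|/tD].
move: s0; rewrite tE big_map => /(ind t (fun i => c (f i)) ut tD) H.
by move=> _ /mapP[i it ->]; exact: H.
Qed.

End LinearSpan.

(** * Leading parts of the family *)

Section Layers.
Context (R : realType) (d k : nat).
Local Notation polyd := {mpoly R[d]}.
Local Notation u := (oneBnormsq R d).
Local Notation rho := (u - 1).
Implicit Types (p q r Y Q : polyd) (n i j m : nat).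

(** The factor of the harmonic polynomials of degree n - 2j; it is 1 for j = 0,
    which makes the first component of the family an instance. *)
Definition layer_factor n j : polyd := \sum_(v < j.+1) coefa R d k n j v *: u ^+ v.

Lemma layer_factor0 n : layer_factor n 0 = 1.
Proof.
rewrite /layer_factor big_ord1 expr0 /coefa subnn expr0 /poch !big_ord0.
by rewrite !mulr1 divr1 scale1r.
Qed.

Lemma u_expr_msize v : (msize (u ^+ v) <= (2 * v).+1)%N.
Proof.
rewrite -[u ^+ v](subrK (rho ^+ v)); apply: msizeD_le_bound.
  exact: leq_trans (u_expr_lead _ _ _) (leqnSn _).
exact/dhomog_msize_le/dhomogMn/u1_homog.
Qed.

Lemma coefa_diag n j : coefa_well_defined R d k n -> (j < k)%N -> (2 * j <= n)%N ->
  coefa R d k n j j = 1.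
Proof.
move=> wd jk jn; rewrite /coefa subnn expr0 mul1r fact0 mulr1 divff//.
apply: mulf_neq0.
  by apply: mulf_neq0; [rewrite pnatr_eq0 -lt0n fact_gt0|exact: poch_Nk_neq0].
apply: poch_neq0 => i ij; have := wd j i ltac:(lia) jn ij.
by rewrite addrAC.
Qed.

Lemma layer_lead m j Y : coefa_well_defined R d k (m + 2 * j) -> (j < k)%N ->
  Y \is m.-homog ->
  (msize (layer_factor (m + 2 * j) j * Y - rho ^+ j * Y) <= m + 2 * j)%N.
Proof.
move=> wd jk hY; rewrite -mulrBl [leqRHS]addnC; apply: msizeM_le_bound; last exact: dhomog_msize_le.
rewrite /layer_factor big_ord_recr/= coefa_diag ?leq_addl// scale1r -addrA.
apply: msizeD_le_bound; last exact: u_expr_lead.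
apply: msize_sum_le_bound => v; apply: msizeZ_le_bound.
by apply: leq_trans (u_expr_msize v) _; have := ltn_ord v; lia.
Qed.

(** Subtract from p its orthogonal projection to the polynomials of lower
    degree. *)
Lemma orth_space_lead m p : p \is m.-homog ->
  exists2 Q, orth_space k%:R m%:Z Q & (msize (Q - p) <= m)%N.
Proof.
move=> hp; pose s := [seq 'X_[R, bmnm b] | b <- enum {: 'X_{1..d < m}}].
have [q qs qo] := orth_projection k p s.
have qm : (msize q <= m)%N.
  apply: (qs (fun r => msize r <= m)%N) => [|a x y xm ym|_ /mapP[b _ ->]].
  - by rewrite msize0.
  - by apply: msizeD_le_bound => //; exact: msizeZ_le_bound.
  - by rewrite msizeX bmdeg.
exists (p - q); last by rewrite addrAC subrr sub0r -scaleN1r msizeZ_le_bound.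
apply/orth_spaceP; split.
  by apply: msizeB_le_bound; [exact: dhomog_msize_le|exact: leqW].
move=> r rm; rewrite (mpolywE rm) raddf_sum big1// => b _.
rewrite /= linearZ/= qo ?mulr0//.
by apply/mapP; exists b; rewrite ?mem_enum.
Qed.

Lemma orth_space_msize_eq0 m Q :
  orth_space k%:R m%:Z Q -> (msize Q <= m)%N -> Q = 0.
Proof. by move=> /orth_spaceP[_ Qo] Qm; apply: (@ip_eq0 _ _ k); exact: Qo. Qed.

(** Components of negative degree are zero: with truncated subtraction, n - 2j
    would be 0 there. *)
Definition homz n j p : Prop :=
  if (2 * j <= n)%N then is_true (p \is (n - 2 * j).-homog) else p = 0.

Definition orthz n Q : Prop :=
  if (2 * k <= n)%N then orth_space k%:R (n - 2 * k)%N%:Z Q else Q = 0.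

(** The sums of one term from each of the components j, j+1, ..., j+i-1 of the
    family and a term of the last component; the span of the family is
    contained in [layers n k 0]. *)
Fixpoint layers n i j : set polyd :=
  match i with
  | 0 => [set u ^+ k * Q | Q in orthz n]
  | i'.+1 => [set f | exists Y w, [/\ homz n j Y, laplacian Y = 0,
       layers n i' j.+1 w & f = layer_factor n j * Y + w]]
  end.

Lemma homz0 n j : homz n j 0.
Proof. by rewrite /homz; case: ifP => // _; exact: rpred0. Qed.

Lemma homz_closed n j a p q : homz n j p -> homz n j q -> homz n j (a *: p + q).
Proof.
rewrite /homz; case: ifP => _; last by move=> -> ->; rewrite scaler0 addr0.
by move=> hp hq; rewrite rpredD// rpredZ.
Qed.

Lemma orthz0 n : orthz n 0.
Proof.
rewrite /orthz; case: ifP => // _; apply/orth_spaceP; rewrite msize0; split=> // q _.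
by rewrite ipC raddf0.
Qed.

Lemma orthz_closed n a p q : orthz n p -> orthz n q -> orthz n (a *: p + q).
Proof.
rewrite /orthz; case: ifP => _; last by move=> -> ->; rewrite scaler0 addr0.
move=> /orth_spaceP[pn po] /orth_spaceP[qn qo]; apply/orth_spaceP; split.
  by apply: msizeD_le_bound => //; exact: msizeZ_le_bound.
by move=> r rn; rewrite ipC linearP/= ![ip k r _]ipC po// qo// mulr0 addr0.
Qed.

Lemma layers0 n i j : layers n i j 0.
Proof.
elim: i j => [|i IHi] j /=; first by exists 0; [exact: orthz0|rewrite mulr0].
by exists 0, 0; split=> //; [exact: homz0|rewrite raddf0|rewrite mulr0 addr0].
Qed.

Lemma layers_closed n i j a f g :
  layers n i j f -> layers n i j g -> layers n i j (a *: f + g).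
Proof.
elim: i j f g => [|i IHi] j f g /=.
  move=> [p hp <-] [q hq <-]; exists (a *: p + q); first exact: orthz_closed.
  by rewrite mulrDr scalerAr.
move=> [Y [w [hY Y0 Lw ->]]] [Z [z [hZ Z0 Lz ->]]].
exists (a *: Y + Z), (a *: w + z); split.
- exact: homz_closed.
- by rewrite linearP/= Y0 Z0 scaler0 addr0.
- exact: IHi.
- by rewrite -!mul_mpolyC; ring.
Qed.

Lemma layers_singleton n i j i' Y : (i' < i)%N -> homz n (j + i') Y -> laplacian Y = 0 ->
  layers n i j (layer_factor n (j + i') * Y).
Proof.
elim: i i' j => [//|i IHi] [|i'] j ii hY Y0 /=.
  exists Y, 0; split=> //; rewrite ?addn0//; [|exact: layers0|by rewrite addr0].
  by move: hY; rewrite addn0.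
exists 0, (layer_factor n (j + i'.+1) * Y).
split=> //; [exact: homz0|by rewrite raddf0| |by rewrite mulr0 add0r].
by rewrite -addSnnS; apply: IHi => //; rewrite addSnnS.
Qed.

Lemma layers_last n i j Q : orthz n Q -> layers n i j (u ^+ k * Q).
Proof.
move=> VQ; elim: i j => [|i IHi] j /=; first by exists Q.
exists 0, (u ^+ k * Q); split=> //; [exact: homz0|by rewrite raddf0|].
by rewrite mulr0 add0r.
Qed.

Lemma Uset_layers n f : (0 < k)%N -> linspan (@Uset R d k n) f -> layers n k 0 f.
Proof.
move=> k0; apply: linspan_ind; [exact: layers0|by move=> a v w; exact: layers_closed|].
move=> v [[[hv v0]|[j /andP[j1 jk] [Y YH <-]]]|[Q VQ <-]].
- have := @layers_singleton n k 0 0 v k0; rewrite /= layer_factor0 mul1r.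
  by apply=> //; rewrite /homz muln0 subn0.
- have [m nE [hY Y0]] := harmonic_spaceP YH.
  have := @layers_singleton n k 0 j Y; rewrite add0n; apply=> //; first by lia.
  by rewrite /homz nE leq_addl addnK.
- apply: layers_last; have [m nE V] := orth_spaceB VQ.
  by rewrite /orthz nE leq_addl addnK.
Qed.

Hypothesis d_gt0 : (0 < d)%N.

(** Injectivity of the map to leading parts, by induction on the number of
    components. The leading part of the whole is rho^j (Y + rho r), with
    rho^(j+1) r that of the later components; if it is zero, then r and Y are
    zero because a nonzero multiple of rho is never harmonic. *)
Lemma layers_lead n i j f : (i + j = k)%N -> coefa_well_defined R d k n ->
  layers n i j f ->
  exists p, [/\ homz n j p, (msize (f - rho ^+ j * p) <= n)%N & p = 0 -> f = 0].
Proof.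
move=> + wd; elim: i j f => [|i IHi] j f ijk /=.
  move: ijk; rewrite add0n => -> [Q + <-]; rewrite /orthz /homz.
  case: ifP => kn; last first.
    by move=> ->; exists 0; split=> //; rewrite !mulr0 ?subrr ?msize0.
  move=> VQ; have [Qm _] := (orth_spaceP _ _ _).1 VQ.
  have [p hp Qp] := msize_sub_homog Qm; exists p; split=> //; last first.
    by move=> p0; move: Qp; rewrite p0 subr0 => /(orth_space_msize_eq0 VQ) ->; rewrite mulr0.
  rewrite (_ : _ - _ = (u ^+ k - rho ^+ k) * Q + (Q - p) * rho ^+ k); last by ring.
  rewrite -(subnKC kn); apply: msizeD_le_bound.
    by apply: msizeM_le_bound => //; exact: u_expr_lead.
  rewrite [leqRHS]addnC; apply: msizeM_le_bound => //.
  exact/dhomog_msize_le/dhomogMn/u1_homog.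
move=> [Y [w [hY Y0 Lw ->]]].
have [r [hr wr r0]] := IHi j.+1 w ltac:(lia) Lw.
exists (Y + rho * r).
have hYr : homz n j (Y + rho * r).
  move: hY hr; rewrite /homz; case: (boolP (2 * j <= n)%N) => jn hY; last first.
    have -> : (2 * j.+1 <= n)%N = false by lia.
    by move=> ->; rewrite hY mulr0 addr0.
  case: (boolP (2 * j.+1 <= n)%N) => jn' hr; last by rewrite hr mulr0 addr0.
  rewrite rpredD// (_ : (n - 2 * j = 2 + (n - 2 * j.+1))%N); last by lia.
  by apply: dhomogM => //; exact: u1_homog.
split=> //.
  rewrite (_ : _ - _ = (layer_factor n j * Y - rho ^+ j * Y) +
    (w - rho ^+ j.+1 * r)); last by rewrite exprS; ring.
  apply: msizeD_le_bound => //; move: hY; rewrite /homz; case: (boolP (2 * j <= n)%N) => jn hY.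
    have nE : n = (n - 2 * j + 2 * j)%N by lia.
    by rewrite nE; apply: layer_lead => //; [rewrite -nE|lia].
  by rewrite hY !mulr0 subrr msize0.
move=> E.
have rz : r = 0.
  move: hr; rewrite /homz; case: ifP => // jn hr.
  exact: fischer_unique d_gt0 Y0 hr E.
by move: E; rewrite rz mulr0 addr0 => ->; rewrite r0// mulr0 addr0.
Qed.

Lemma Uset_msize_eq0 n f : (0 < k)%N -> coefa_well_defined R d k n ->
  linspan (@Uset R d k n) f -> (msize f <= n)%N -> f = 0.
Proof.
move=> k0 wd /(Uset_layers k0) Lf fn.
have [p [hp fp p0]] := layers_lead (addn0 k) wd Lf.
apply: p0; move: hp; rewrite /homz muln0 subn0 /= => hp.
apply: (homog_msize_eq0 hp); move: fp; rewrite expr0 mul1r => fp.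
by rewrite -(subKr f p); exact: msizeB_le_bound.
Qed.

(** Surjectivity of the map to leading parts, along p = Y + rho r. *)
Lemma Uset_lead_rho n i j m p : (0 < k)%N -> coefa_well_defined R d k n ->
  (i + j = k)%N -> n = (m + 2 * j)%N -> p \is m.-homog ->
  exists2 f, linspan (@Uset R d k n) f & (msize (f - rho ^+ j * p) <= n)%N.
Proof.
move=> k0 wd; elim: i j m p => [|i IHi] j m p ijk nE hp.
  move: ijk nE; rewrite add0n => -> nE.
  have [Q VQ Qp] := orth_space_lead hp; exists (u ^+ k * Q).
    apply: linspan_sub; right; exists Q => //.
    by rewrite nE subzn ?leq_addl// addnK.
  have [Qm _] := (orth_spaceP _ _ _).1 VQ.
  rewrite (_ : _ - _ = (u ^+ k - rho ^+ k) * Q + (Q - p) * rho ^+ k); last by ring.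
  rewrite nE; apply: msizeD_le_bound.
    by rewrite [leqRHS]addnC; apply: msizeM_le_bound => //; exact: u_expr_lead.
  apply: msizeM_le_bound => //.
  exact/dhomog_msize_le/dhomogMn/u1_homog.
have single Y : Y \is m.-homog -> laplacian Y = 0 ->
    linspan (@Uset R d k n) (layer_factor n j * Y).
  move=> hY Y0; apply: linspan_sub; left.
  case: (posnP j) => [j0|j0].
    left; rewrite j0 layer_factor0 mul1r; split=> //.
    by move: nE; rewrite j0 muln0 addn0 => ->.
  right; exists j => /=; first by apply/andP; split; lia.
  by exists Y => //; rewrite nE subzn ?leq_addl// addnK.
have lead Y : Y \is m.-homog -> (msize (layer_factor n j * Y - rho ^+ j * Y) <= n)%N.
  by rewrite nE; apply: layer_lead; [rewrite -nE|lia].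
have [m2|] := ltnP m 2.
  exists (layer_factor n j * p); last exact: lead.
  by apply: single => //; exact: laplacian_lt2 m2 hp.
case: m nE hp single lead => [//|[//|m]] nE hp single lead _.
have [Y [r [hY Y0 hr ->]]] := fischer_decomposition d_gt0 hp.
have [f Uf fr] := IHi j.+1 m r ltac:(lia) ltac:(lia) hr.
exists (1 *: (layer_factor n j * Y) + f).
  by apply: linspan_closed => //; exact: single.
rewrite scale1r (_ : _ - _ = (layer_factor n j * Y - rho ^+ j * Y) +
  (f - rho ^+ j.+1 * r)); last by rewrite exprS; ring.
by apply: msizeD_le_bound => //; exact: lead.
Qed.

Lemma Uset_lead n p : (0 < k)%N -> coefa_well_defined R d k n -> p \is n.-homog ->
  exists2 f, linspan (@Uset R d k n) f & (msize (f - p) <= n)%N.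
Proof.
move=> k0 wd hp; have [f Uf] := @Uset_lead_rho n k 0 n p k0 wd (addn0 k) (esym (addn0 n)) hp.
by rewrite expr0 mul1r => fp; exists f.
Qed.

End Layers.

(** * Families with prescribed leading monomials *)

Section TriangularFamilies.
Context (R : realType) (d : nat).
Local Notation polyd := {mpoly R[d]}.
Local Notation mono := 'X_{1..d}.
Implicit Types (p q : polyd) (n : nat).

Definition triangular (D : set mono) (f : mono -> polyd) : Prop :=
  forall m, D m -> (msize (f m - 'X_[m]) <= mdeg m)%N.

Lemma triangular_mcoeff (D : set mono) f m m' : triangular D f -> D m ->
  (mdeg m <= mdeg m')%N -> (f m)@_m' = (m == m')%:R.
Proof.
move=> tf Dm mm'; rewrite -mcoeffX; apply/eqP; rewrite -subr_eq0 -mcoeffB.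
by apply/eqP/memN_msupp_eq0/msize_mdeg_ge; exact: leq_trans (tf m Dm) mm'.
Qed.

(** The coefficients vanish by descending induction on the degree of m: at the
    monomial m, only members of higher degree could contribute. *)
Lemma triangular_free (D : set mono) f (s : seq mono) (c : mono -> R) :
  triangular D f -> uniq s -> (forall m, m \in s -> D m) ->
  \sum_(m <- s) c m *: f m = 0 -> forall m, m \in s -> c m = 0.
Proof.
move=> tf us sD s0; have [N] := ubnP (\max_(m <- s) mdeg m).
have all_le m : m \in s -> (mdeg m <= \max_(m <- s) mdeg m)%N.
  by move=> ms; exact: leq_bigmax_seq.
suff H n m : m \in s -> (\max_(m <- s) mdeg m - mdeg m < n)%N -> c m = 0.
  by move=> _ m ms; exact: (H _ m ms (ltnSn _)).
elim: n m => [//|n IHn] m ms mn.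
have := congr1 (mcoeff m) s0; rewrite mcoeff0 raddf_sum (bigD1_seq m)//= mcoeffZ.
rewrite (triangular_mcoeff tf (sD _ ms))// eqxx mulr1 big_seq_cond big1 ?addr0//.
move=> m' /andP[m's m'm]; rewrite mcoeffZ.
have [le|lt] := leqP (mdeg m') (mdeg m).
  by rewrite (triangular_mcoeff tf (sD _ m's))// (negPf m'm) mulr0.
rewrite IHn ?mul0r//; have := all_le m' m's; have := all_le m ms.
by move: lt mn; lia.
Qed.

Lemma triangular_inj (D : set mono) f m m' : triangular D f -> D m -> D m' ->
  f m = f m' -> m = m'.
Proof.
move=> tf Dm Dm' E; apply: contrapT => /eqP mm'.
have := @triangular_free D f [:: m; m'] (fun x => if x == m then 1 else -1) tf.
rewrite /= inE mm' => /(_ isT) H.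
have : (1 : R) = 0.
  have := H _ _ m; rewrite eqxx mem_head; apply=> //.
    by move=> x; rewrite !inE => /orP[] /eqP ->.
  by rewrite !big_cons big_nil eqxx eq_sym (negPf mm') E scale1r scaleN1r addr0 subrr.
by move/eqP; rewrite oner_eq0.
Qed.

Lemma triangular_linfree (D : set mono) f : triangular D f -> linfree (f @` D).
Proof. by move=> tf; apply: linfree_image => s c; exact: triangular_free tf. Qed.

Lemma has_dim_triangular n f (S : set polyd) (s : seq mono) :
  uniq s -> triangular [set` s] f -> linspan (f @` [set` s]) = S ->
  has_dim S (size s).
Proof.
move=> us tf <-; exists (map_tuple f (in_tuple s)).
have -> : [set` map_tuple f (in_tuple s)] = f @` [set` s].
  apply/seteqP; split => [x /mapP[m ms ->]|_ [m ms <-]]; first by exists m.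
  by apply/mapP; exists m.
split; last by split=> //; exact: triangular_linfree.
by rewrite map_inj_in_uniq// => m m' ms m's; exact: triangular_inj tf ms m's.
Qed.

Definition monos n : seq mono := [seq bmnm b | b <- enum {: 'X_{1..d < n.+1}} & mdeg (bmnm b) == n].

Lemma monos_uniq n : uniq (monos n).
Proof.
rewrite map_inj_uniq; first exact/filter_uniq/enum_uniq.
by move=> b b' bb'; apply: val_inj.
Qed.

Lemma mem_monos n m : (m \in monos n) = (mdeg m == n).
Proof.
apply/mapP/idP => [[b]|/eqP mn]; first by rewrite mem_filter => /andP[bn _] ->.
have mn1 : (mdeg m < n.+1)%N by rewrite mn.
by exists (BMultinom mn1); rewrite // mem_filter /= mn eqxx mem_enum.
Qed.

Lemma triangular_lead_sum n f p : p \is n.-homog ->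
  triangular [set m | mdeg m = n] f ->
  (msize (\sum_(m <- msupp p) p@_m *: f m - p) <= n)%N.
Proof.
move=> /dhomogP hp tf; rewrite {3}(mpolyE p) -sumrB big_seq.
apply: (big_ind (fun q => (msize q <= n)%N)) => [|q r|m mp].
- by rewrite msize0.
- exact: msizeD_le_bound.
by rewrite -scalerBr msizeZ_le_bound// -[X in (_ <= X)%N](hp m mp) tf//; exact: hp.
Qed.

End TriangularFamilies.

(** * Dimension and completeness *)

Section Main.
Context (R : realType) (d k : nat).
Hypotheses (d_gt0 : (0 < d)%N) (k_gt0 : (0 < k)%N).
Local Notation polyd := {mpoly R[d]}.
Local Notation mono := 'X_{1..d}.

Lemma Uset_triangular_family n : coefa_well_defined R d k n ->
  exists f : mono -> polyd, triangular [set m | mdeg m = n] f /\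
    forall m, mdeg m = n -> linspan (@Uset R d k n) (f m).
Proof.
move=> wd.
have H (m : mono) : exists g : polyd, mdeg m = n ->
    linspan (@Uset R d k n) g /\ (msize (g - 'X_[m]) <= n)%N.
  have [mn|mn] := eqVneq (mdeg m) n; last by exists 0 => /eqP; rewrite (negPf mn).
  have hX : 'X_[R, m] \is n.-homog by rewrite dhomogX; apply/eqP.
  have [f Uf fX] := Uset_lead d_gt0 k_gt0 wd hX.
  by exists f.
have [f Hf] := choice H; exists f; split => m mn; last by have [] := Hf m mn.
by have [_] := Hf m mn; rewrite mn.
Qed.

(** An element of the span and the combination of the family with the same
    leading part differ by an element of the span of degree less than n. *)
Lemma linspan_Uset_triangular n f : coefa_well_defined R d k n ->
  triangular [set m | mdeg m = n] f ->
  (forall m, mdeg m = n -> linspan (@Uset R d k n) (f m)) ->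
  linspan (f @` [set m | mdeg m = n]) = linspan (@Uset R d k n).
Proof.
move=> wd tf Uf; apply/seteqP; split.
  apply: linspan_ind; [exact: linspan0|by move=> a v w; exact: linspan_closed|].
  by move=> _ [m mn <-]; exact: Uf.
move=> v Uv.
have [p hp vp] : exists2 p, p \is n.-homog & (msize (v - p) <= n)%N.
  have [p [hp vp _]] := layers_lead d_gt0 (addn0 k) wd (Uset_layers k_gt0 Uv).
  by exists p; move: hp vp; rewrite /homz muln0 subn0 expr0 mul1r.
pose g := \sum_(m <- msupp p) p@_m *: f m.
have supp m : m \in msupp p -> mdeg m = n by move/dhomogP: hp => hp; exact: hp.
suff -> : v = g.
  by apply: linspan_sum => m mp; apply/linspanZ/linspan_sub; exists m => //; exact: supp.
apply/eqP; rewrite -subr_eq0; apply/eqP; apply: (Uset_msize_eq0 d_gt0 k_gt0 wd).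
  by apply: linspanB => //; apply: linspan_sum => m mp; apply/linspanZ/Uf; exact: supp.
rewrite (_ : v - g = (v - p) - (g - p)); last by rewrite opprB addrA subrK.
by apply: msizeB_le_bound => //; exact: triangular_lead_sum.
Qed.

Lemma dim_Uset n : coefa_well_defined R d k n ->
  exists N : nat, has_dim (linspan (@Uset R d k n)) N /\ has_dim (@homog_space R d n) N.
Proof.
move=> wd; have [f [tf Uf]] := Uset_triangular_family wd.
have sE : [set` monos d n] = [set m | mdeg m = n].
  by apply/seteqP; split => m /=; rewrite mem_monos => /eqP.
exists (size (monos d n)); split.
  apply: (has_dim_triangular n (monos_uniq d n) (f := f)); rewrite sE//.
  exact: linspan_Uset_triangular.
apply: (has_dim_triangular n (monos_uniq d n) (f := fun m => 'X_[m])); rewrite sE.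
  by move=> m _; rewrite subrr msize0.
apply/seteqP; split.
  apply: linspan_ind => [|a v w hv hw|_ [m mn <-]]; rewrite /homog_space/=.
  - exact: rpred0.
  - by rewrite rpredD// rpredZ.
  - by rewrite dhomogX; apply/eqP.
move=> p /dhomogP hp; rewrite (mpolyE p); apply: linspan_sum => m mp.
by apply/linspanZ/linspan_sub; exists m => //; exact: hp.
Qed.

(** The denominators are half-integers. *)
Lemma odd_coefa_well_defined n : odd d -> coefa_well_defined R d k n.
Proof.
move=> od j v _ _ _; apply/eqP => E.
have : (2 * n + 2 * v + d)%N%:R = (2 * j + 2 * k)%N%:R :> R.
  apply/eqP; rewrite -subr_eq0 -[X in _ == X](mulr0 2) -E.
  by apply/eqP; field.
move/eqP; rewrite eqr_nat => /eqP /(congr1 odd).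
by rewrite !mul2n -!doubleD oddD !odd_double od.
Qed.

Lemma complete_eigenbasis : (forall n, coefa_well_defined R d k n) ->
  complete_polynomial_eigenbasis (@Lop R d (- k%:R)).
Proof.
move=> wd; have [F HF] := choice (fun n => Uset_triangular_family (wd n)).
pose f (m : mono) : polyd := F (mdeg m) m.
have tf : triangular setT f by move=> m _; apply: (HF (mdeg m)).1.
exists (range f); split.
  move=> _ [m _ <-]; split.
    apply/eqP => fm0; have := triangular_mcoeff tf I (leqnn (mdeg m)).
    by rewrite eqxx fm0 mcoeff0 => /eqP; rewrite eq_sym oner_eq0.
  exists (lambda d (- k%:R) (mdeg m)).
  move: ((HF (mdeg m)).2 m erefl); rewrite -/(f m); move: (mdeg m) (f m) => n.
  apply: linspan_ind => [|a v w vE wE|v]; first by rewrite raddf0 scaler0.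
    by rewrite linearP/= vE wE scalerDr !scalerA mulrC.
  exact: Uset_eigen.
split; first exact: triangular_linfree.
apply/seteqP; split => // p _; have [n] := ubnP (msize p); elim: n p => // n IHn p.
rewrite ltnS => pn; have [/msize_le0 ->|] := leqP (msize p) 0; first exact: linspan0.
move=> p0; pose s := (msize p).-1.
have [q hq pq] : exists2 q, q \is s.-homog & (msize (p - q) <= s)%N.
  by apply: msize_sub_homog; rewrite /s prednK.
pose g := \sum_(m <- msupp q) q@_m *: f m.
have -> : p = 1 *: g + (p - g) by rewrite scale1r addrC subrK.
apply: linspan_closed.
  by apply: linspan_sum => m _; apply/linspanZ/linspan_sub; exists m.
apply: IHn; rewrite (_ : p - g = (p - q) - (g - q)); last by rewrite opprB addrA subrK.
have : (msize ((p - q) - (g - q)) <= s)%N.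
  apply: msizeB_le_bound => //; apply: triangular_lead_sum => // m _; exact: tf.
by move=> /leq_ltn_trans; apply; rewrite /s prednK.
Qed.

End Main.

Theorem theorem3p4 (R : realType) (d k : nat) (hd : (0 < d)%N) (hk : (2 <= k)%N) :
  (forall (n : nat) (P : {mpoly R[d]}), Uset k n P ->
     Lop (- k%:R) P = lambda d (- k%:R) n *: P /\
     lambda d (- k%:R) n = - (n%:R * (n%:R - 2 * k%:R + d%:R)) :> R) /\
  (forall n : nat, coefa_well_defined R d k n ->
     n%:R - 2 * k%:R - 1 + d%:R / 2 != 0 :> R ->
     exists N : nat,
       has_dim (linspan (@Uset R d k n)) N /\ has_dim (@homog_space R d n) N) /\
  (odd d -> complete_polynomial_eigenbasis (@Lop R d (- k%:R))).
Proof.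
have k0 : (0 < k)%N by exact: ltnW.
split=> [n P UP|].
  split; first exact: Uset_eigen.
  by rewrite /lambda mulrN.
split=> [n wd _|od]; first exact: dim_Uset.
by apply: complete_eigenbasis => // n; exact: odd_coefa_well_defined.
Qed.
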